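(* There exist a finite alphabet $\mathcal{A}$ and a nearest neighbor $\mathbb{Z}^2$-shift of finite type $Y\subset\mathcal{A}^{\mathbb{Z}^2}$ such that: (1) $Y$ does not have the pivot property; (2) there is an uncountable family of linearly independent shift-invariant Markov cocycles on $Y$, each of which has a corresponding shift-invariant Markov random field $\mu$ with $\mathrm{supp}(\mu)=Y$ (in particular the space of shift-invariant Markov cocycles on $Y$ has uncountable dimension); (3) there exists a shift-invariant Markov random field $\mu$ with $\mathrm{supp}(\mu)=Y$ which is not Gibbs for any shift-invariant finite range interaction, i.e. the Markov cocycle corresponding to $\mu$ is not equal to $M_\phi$ for any shift-invariant finite range interaction $\phi$ on $Y$.
   Context: $\mathbb{Z}^2$ is regarded as the vertex set of the graph in which $n,m$ are adjacent iff $\|n-m\|_1=1$. For $F\subset\mathbb{Z}^2$, $\partial F$ is the set of sites outside $F$ adjacent to some site of $F$. For finite $F$ and $x\in\mathcal{A}^{\mathbb{Z}^2}$, $[x]_F=\{x': x'|_F=x|_F\}$. The shift action is $(\sigma_n x)_m=x_{m+n}$. A nearest neighbor shift of finite type is a set of all $x\in\mathcal{A}^{\mathbb{Z}^2}$ avoiding (in all translates) a finite set of forbidden patterns each supported on a single edge. A Markov random field is a Borel probability measure $\mu$ on $\mathcal{A}^{\mathbb{Z}^2}$ such that for all finite $A,B$ with $\partial A\subset B\subset A^c$ and all $a\in\mathcal{A}^A$, $b\in\mathcal{A}^B$ with $\mu([b]_B)>0$, $\mu([a]_A\mid[b]_B)=\mu([a]_A\mid[b|_{\partial A}]_{\partial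 A})$. It is shift-invariant if $\mu\circ\sigma_n=\mu$ for all $n$. $\Delta_X$ is the set of pairs $(x,y)\in X\times X$ with $x_n=y_n$ for all but finitely many $n$. $X$ has the pivot property if any $(x,y)\in\Delta_X$ with $x\neq y$ can be joined by a finite sequence of points of $X$ in which consecutive points differ at exactly one site. A $\Delta_X$-cocycle is a function $M:\Delta_X\to\mathbb{R}$ with $M(x,z)=M(x,y)+M(y,z)$ whenever $(x,y),(y,z)\in\Delta_X$. It is a Markov cocycle if, for every finite $F$ and all $(x,y)\in\Delta_X$ with $x|_{F^c}=y|_{F^c}$, $M(x,y)$ is determined by $x|_{F\cup\partial F}$ and $y|_{F\cup\partial F}$. It is shift-invariant if $M(\sigma_n x,\sigma_n y)=M(x,y)$ for all $n$. A Markov random field $\mu$ with $\mathrm{supp}(\mu)=X$ and a Markov cocycle $M$ on $X$ correspond to each other if $\mu([y]_\Lambda)/\mu([x]_\Lambda)=e^{M(x,y)}$ for all $(x,y)\in\Delta_X$ and all finite $\Lambda\supset F\cup\partial F$, where $F$ is the set of sites at which $x,y$ differ. $\mathcal{B}(X)$ is the set of all patterns $x|_W$, $x\in X$, $W\subset\mathbb{Z}^2$ finite. A finite range interaction on $X$ is a function $\phi:\mathcal{B}(X)\to\mathbb{R}$ for which there is $k$ with $\phi(a)=0$ whenever the set on which $a$ is defined has diameter greater than $k$; it is shift-invariant if it takes the same value on a pattern and all its translates. $M_\phi(x,y)=\sum_{W\text{ finite}}\big(\phi(y|_W)-\phi(x|_W)\big)$. *)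

(* Defs.v *)
From HB Require Import structures.
From mathcomp Require Import all_boot all_order all_algebra.
From mathcomp Require Import finmap zify.
From mathcomp Require Import all_classical all_reals all_analysis.

Set Implicit Arguments.
Unset Strict Implicit.
Unset Printing Implicit Defensive.

Import Order.TTheory GRing.Theory Num.Theory.

Local Open Scope classical_set_scope.
Local Open Scope ring_scope.

(* The library's measurable spaces are pointed, so the alphabets carry a
   distinguished letter; it plays no other role. *)
#[short(type="finPointedType")]
HB.structure Definition FinPointed := {T of Finite T & Pointed T}.

Definition site : choiceType := (int * int)%type.

Definition norm1 (n : site) : nat := (absz n.1 + absz n.2)%N.

Definition adjacent (n m : site) : bool := norm1 (n - m) == 1%N.

Definition neighbours (n : site) : {fset site} :=
  let: (i, j) := n in
  [fset ((i + 1)%R, j); ((i - 1)%R, j); (i, (j + 1)%R); (i, (j - 1)%R)]%fset.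

Definition boundary (F : {fset site}) : {fset site} :=
  ((\bigcup_(n <- F) neighbours n) `\` F)%fset.

Lemma in_neighbours (n m : site) : (m \in neighbours n) = adjacent n m.
Proof.
case: n m => [n1 n2] [m1 m2]; rewrite !inE /adjacent /norm1 /= !xpair_eqE.
by apply/idP/idP; lia.
Qed.

Lemma in_boundary (F : {fset site}) (m : site) :
  (m \in boundary F) = (m \notin F) && has (fun n => adjacent n m) F.
Proof.
rewrite !inE; congr (_ && _); apply/bigfcupP/hasP.
  by move=> [n]; rewrite andbT in_neighbours => nF nm; exists n.
by move=> [n nF nm]; exists n; rewrite ?nF ?in_neighbours.
Qed.

Definition diameter (W : {fset site}) : nat :=
  \max_(n <- W) \max_(m <- W) norm1 (n - m)%R.

Definition config (A : finPointedType) : Type :=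
  {ptws site -> discrete_topology A}.

HB.instance Definition _ (A : finPointedType) := Topological.on (config A).
HB.instance Definition _ (A : finPointedType) := Pointed.on (config A).

Definition borel_config (A : finPointedType) :=
  g_sigma_algebraType (open : set (set (config A))).

Definition shift (A : finPointedType) (n : site) (x : config A) : config A :=
  fun m => x (m + n).

(* A pattern is its own support (a finite set of sites) together with the
   letters on it. *)
Definition pattern (A : finPointedType) := {fmap site -> A}.

Definition restrict (A : finPointedType) (x : config A) (W : {fset site}) :
  pattern A := [fmap n : W => x (val n)]%fmap.

Definition cylinder (A : finPointedType) (a : pattern A) : set (config A) :=
  [set x | restrict x (domf a) = a].

Definition is_nn_sft (A : finPointedType) (X : set (config A)) : Prop :=
  exists2 forbidden : {fset pattern A},
    (forall a, a \in forbidden ->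
      exists n m, adjacent n m /\ domf a = [fset n; m]%fset) &
    X = [set x | forall a n, a \in forbidden -> ~ cylinder a (shift n x)].

Definition asymptotic_pair (A : finPointedType) (X : set (config A))
    (x y : config A) : Prop :=
  [/\ X x, X y & finite_set [set n | x n <> y n]].

Definition pivot_property (A : finPointedType) (X : set (config A)) : Prop :=
  forall x y, asymptotic_pair X x y -> x <> y ->
  exists (N : nat) (z : nat -> config A),
    [/\ z 0%N = x, z N = y,
        forall i, (i <= N)%N -> X (z i) &
        forall i, (i < N)%N -> exists! n, z i n <> z i.+1 n].

(* Cocycles are functions on asymptotic pairs: they are represented by
   functions on all pairs of configurations, of which only the values on
   asymptotic pairs are ever used. *)
Definition pair_fun (A : finPointedType) (R : realType) :=
  config A -> config A -> R.

Definition is_cocycle (A : finPointedType) (R : realType)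
    (X : set (config A)) (M : pair_fun A R) : Prop :=
  forall x y z, asymptotic_pair X x y -> asymptotic_pair X y z ->
    M x z = M x y + M y z.

Definition is_markov_cocycle (A : finPointedType) (R : realType)
    (X : set (config A)) (M : pair_fun A R) : Prop :=
  is_cocycle X M /\
  forall (F : {fset site}) x y x' y',
    asymptotic_pair X x y -> asymptotic_pair X x' y' ->
    (forall n, n \notin F -> x n = y n) ->
    (forall n, n \notin F -> x' n = y' n) ->
    restrict x (F `|` boundary F)%fset = restrict x' (F `|` boundary F)%fset ->
    restrict y (F `|` boundary F)%fset = restrict y' (F `|` boundary F)%fset ->
    M x y = M x' y'.

Definition is_shift_inv_markov_cocycle (A : finPointedType) (R : realType)
    (X : set (config A)) (M : pair_fun A R) : Prop :=
  is_markov_cocycle X M /\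
  forall n x y, asymptotic_pair X x y -> M (shift n x) (shift n y) = M x y.

Definition linearly_independent (A : finPointedType) (R : realType)
    (X : set (config A)) (I : Type) (M : I -> pair_fun A R) : Prop :=
  forall (k : nat) (i : 'I_k -> I) (c : 'I_k -> R), injective i ->
    (forall x y, asymptotic_pair X x y -> \sum_j c j * M (i j) x y = 0) ->
    forall j, c j = 0.

Definition is_basis_of_cocycles (A : finPointedType) (R : realType)
    (X : set (config A)) (I : Type) (M : I -> pair_fun A R) : Prop :=
  [/\ forall i, is_shift_inv_markov_cocycle X (M i),
      linearly_independent X M &
      forall M', is_shift_inv_markov_cocycle X M' ->
        exists (k : nat) (i : 'I_k -> I) (c : 'I_k -> R),
          forall x y, asymptotic_pair X x y ->
            M' x y = \sum_j c j * M (i j) x y].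

Definition cond_prob (A : finPointedType) (R : realType)
    (mu : probability (borel_config A) R) (E G : set (config A)) : R :=
  fine (mu (E `&` G)) / fine (mu G).

(* The domains of the patterns a and b are the finite sets over which the
   Markov property quantifies. *)
Definition is_mrf (A : finPointedType) (R : realType)
    (mu : probability (borel_config A) R) : Prop :=
  forall a b : pattern A,
    (boundary (domf a) `<=` domf b)%fset ->
    [disjoint domf a & domf b]%fset ->
    (0 < mu (cylinder b))%E ->
    cond_prob mu (cylinder a) (cylinder b) =
    cond_prob mu (cylinder a) (cylinder b.[& boundary (domf a)]%fmap).

Definition is_shift_inv_measure (A : finPointedType) (R : realType)
    (mu : probability (borel_config A) R) : Prop :=
  forall n (E : set (borel_config A)), measurable E ->
    mu (@shift A n @` E) = mu E.

Definition msupport (A : finPointedType) (R : realType)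
    (mu : probability (borel_config A) R) : set (config A) :=
  [set x | forall U : set (config A), open U -> U x -> (0 < mu U)%E].

Definition is_shift_inv_mrf_on (A : finPointedType) (R : realType)
    (X : set (config A)) (mu : probability (borel_config A) R) : Prop :=
  [/\ is_mrf mu, is_shift_inv_measure mu & msupport mu = X].

Definition diff_sites (A : finPointedType) (x y : config A) : {fset site} :=
  fset_set [set n | x n <> y n].

Definition corresponds (A : finPointedType) (R : realType)
    (X : set (config A)) (mu : probability (borel_config A) R)
    (M : pair_fun A R) : Prop :=
  forall x y (L : {fset site}), asymptotic_pair X x y ->
    (diff_sites x y `|` boundary (diff_sites x y) `<=` L)%fset ->
    fine (mu (cylinder (restrict y L))) / fine (mu (cylinder (restrict x L))) =
    expR (M x y).

Definition language (A : finPointedType) (X : set (config A)) :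
    set (pattern A) :=
  [set a | exists x W, X x /\ a = restrict x W].

Definition translates (A : finPointedType) (a b : pattern A) : Prop :=
  exists n : site, forall m, (b.[? m] = a.[? m + n])%fmap.

(* An interaction is a function on the language of X; its values at other
   patterns are never used. *)
Definition finite_range (A : finPointedType) (R : realType)
    (X : set (config A)) (phi : pattern A -> R) : Prop :=
  exists k : nat, forall a, language X a -> (k < diameter (domf a))%N ->
    phi a = 0.

Definition shift_inv_interaction (A : finPointedType) (R : realType)
    (X : set (config A)) (phi : pattern A -> R) : Prop :=
  forall a b, language X a -> language X b -> translates a b -> phi a = phi b.

(* For a finite range interaction and an asymptotic pair only finitely many
   terms are nonzero, so that the finitely supported sum is the full one. *)
Definition gibbs_cocycle (A : finPointedType) (R : realType)
    (phi : pattern A -> R) : pair_fun A R :=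
  fun x y => \sum_(W \in [set: {fset site}])
    (phi (restrict y W) - phi (restrict x W)).

(* Main.v *)
Require Import Defs.
From HB Require Import structures.
From mathcomp Require Import all_boot all_order all_algebra.
From mathcomp Require Import finmap zify ring lra.
From mathcomp Require Import all_classical all_reals all_analysis.
From mathcomp Require Import measurable_realfun.

(* The names restrict and shift also denote other notions of analysis. *)
Import Defs.
Import Order.TTheory GRing.Theory Num.Theory.

Local Open Scope classical_set_scope.
Local Open Scope ring_scope.

Set Implicit Arguments.
Unset Strict Implicit.
Unset Printing Implicit Defensive.

(** The alphabet has a wall, [None], and two colours, [Some b].  In the cell
    shift walls are repeated along columns and horizontally adjacent colours
    agree, so that the walls cut each row into horizontal runs, the cells, and
    each cell carries one colour that can be chosen freely.  Asymptotic points
    have the same walls, since a column that contains a wall consists of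
    walls; they differ by the colours of finitely many bounded cells.  A cell
    of width two changes colour at both of its sites at once, which rules out
    the pivot property.

    Let the colour [Some true] of a cell of width w have an energy [lam w],
    for an arbitrary function [lam].  A cell together with its boundary shows
    the width of the cell, hence the total change of energy is a
    shift-invariant Markov cocycle, [cell_cocycle lam].  The functions
    w |-> s ^ (w - 1), for s real, give an independent family, because a
    dependency would extend from powers to all polynomials; by Zorn's lemma the
    family extends to a basis of the space of shift-invariant Markov cocycles.

    Each [cell_cocycle lam] has a Markov random field.  For fixed walls, colour
    the cells by independent coins with odds [expR (lam w)]; changing the
    colours of finitely many cells then multiplies the probability of a
    cylinder by the exponential of the cocycle ([law_ratio]).  This factor is
    the same for all walls, so that it persists when the walls are random.
    The walls are drawn uniformly among those of period k + 2, and k has a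
    geometric law: this countable mixture, [cell_measure], is shift-invariant
    and charges every finite piece of walls, hence it has full support.  The
    Markov property now follows from the support and the correspondence with a
    cocycle ([corresponds_mrf]): given what happens outside a finite set, the
    conditional probabilities of the patterns inside are known up to a factor
    from their ratios, and these depend only on the boundary.

    The cocycle of a finite range interaction is bounded by a constant times the
    number of sites where the two points differ ([gibbs_cocycle_le]).  With [lam w] equal to the square of
    w, the cocycle of a single cell grows faster than that. *)

(** * Cylinders and the Borel sigma-algebra *)

Section Cylinders.
Context {A : finPointedType}.
Implicit Types (x y : config A) (W : {fset site}) (a b : pattern A).

Lemma fnd_restrict_config x W n :
  (restrict x W).[? n]%fmap = if n \in W then Some (x n) else None.
Proof. by rewrite /restrict; case: fndP => //= kf; rewrite ffunE. Qed.

Lemma eq_restrict x y W :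
  restrict x W = restrict y W <-> forall n, n \in W -> x n = y n.
Proof.
split=> [/fmapP xy n nW|xy].
  by have := xy n; rewrite !fnd_restrict_config nW => -[].
by apply/fmapP => n; rewrite !fnd_restrict_config; case: ifP => // /xy ->.
Qed.

Lemma cylinder_restrict x y W :
  cylinder (restrict x W) y <-> forall n, n \in W -> y n = x n.
Proof. exact: eq_restrict. Qed.

Lemma cylinderP a y :
  cylinder a y <-> forall n, n \in domf a -> a.[? n]%fmap = Some (y n).
Proof.
split=> [<- n /= nW|ay]; first by rewrite fnd_restrict_config nW.
apply/fmapP => n; rewrite fnd_restrict_config; case: ifPn => [/ay //|na].
by rewrite not_fnd.
Qed.

Lemma cylinderI a b x : cylinder a x -> cylinder b x ->
  cylinder a `&` cylinder b = cylinder (restrict x (domf a `|` domf b)%fset).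
Proof.
move=> + +; rewrite /cylinder /= => <- <- /=; apply/seteqP; split=> y /=.
  move=> [] /eq_restrict ya /eq_restrict yb; apply/eq_restrict => n.
  by rewrite inE => /orP[/ya|/yb].
by move=> /eq_restrict yab; split; apply/eq_restrict => n nW; apply: yab;
  rewrite inE nW ?orbT.
Qed.

Lemma cylinder_bigcap a :
  cylinder a = \bigcap_(n in [set` domf a]) [set y | a.[? n]%fmap = Some (y n)].
Proof. by apply/seteqP; split=> y /cylinderP. Qed.

Lemma open_letter n (l : option A) :
  open [set x : config A | l = Some (x n)].
Proof.
have -> : [set x : config A | l = Some (x n)] =
    @proj site (fun=> discrete_topology A) n @^-1` [set t | l = Some t] by [].
apply: open_comp => [y _|]; first exact: proj_continuous.
exact: discrete_open.
Qed.

Lemma open_cylinder a : open (cylinder a).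
Proof.
rewrite cylinder_bigcap bigcap_fset; apply: (big_ind (@open (config A))).
- exact: openT.
- exact: openI.
- by move=> n _; exact: open_letter.
Qed.

(** If no finite window sufficed, there would be points outside [U] that agree
    with [x] on the first k sites of an enumeration, for all k; they converge
    to [x]. *)
Lemma open_sub_cylinder (U : set (config A)) x : open U -> U x ->
  exists W, cylinder (restrict x W) `<=` U.
Proof.
move=> oU Ux; apply: contrapT => /forallNP noW.
pose W k : {fset site} := fset_set [set n : site | (choice.pickle n < k)%N].
have finW k : finite_set [set n : site | (choice.pickle n < k)%N].
  apply: (@finite_preimage _ _ `I_k (@choice.pickle site)); last exact: finite_II.
  by move=> u v _ _; exact: (pcan_inj choice.pickleK).
have /choice[z zP] k : exists y, cylinder (restrict x (W k)) y /\ ~ U y.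
  by have /existsNP[y /not_implyP] := noW (W k); exists y.
have zx : z @ \oo --> x.
  apply/cvg_sup => n.
  move=> V [B [[C oC <-] Cx] BV].
  exists (choice.pickle n).+1 => // k /= kn; apply: BV => /=.
  have [/cylinder_restrict/(_ n) zk _] := zP k.
  by rewrite /= zk // in_fset_set // inE.
have [N _ /(_ N (leqnn N))] := zx _ (open_nbhs_nbhs (conj oU Ux)).
by case: (zP N).
Qed.

Lemma open_bigcup_cylinder (U : set (config A)) : open U ->
  U = \bigcup_(a in [set a | cylinder a `<=` U]) cylinder a.
Proof.
move=> oU; apply/seteqP; split=> [x Ux|x [a aU /aU]//].
have [W WU] := open_sub_cylinder oU Ux.
by exists (restrict x W) => //; exact/cylinder_restrict.
Qed.

Definition cylinders : set (set (borel_config A)) :=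
  [set E | E = set0 \/ exists a, E = cylinder a].

(** An open set is a union of cylinders, and there are countably many
    patterns. *)
Lemma borel_cylinders : @measurable _ (borel_config A) = <<s cylinders >>.
Proof.
apply/seteqP; split; last first.
  apply: smallest_sub; first exact: sigma_algebra_measurable.
  move=> _ [->|[a ->]]; first exact: measurable0.
  by apply: sub_sigma_algebra; exact: open_cylinder.
apply: smallest_sub; first exact: smallest_sigma_algebra.
move=> U /open_bigcup_cylinder ->.
rewrite bigcup_mkcond.
apply: (@countable_bigcupT_measurable _ (g_sigma_algebraType cylinders)).
  exact: countableP.
move=> a; case: ifP => _; last exact: measurable0.
by apply: sub_sigma_algebra; right; exists a.
Qed.

Lemma measurable_cylinder a : measurable (cylinder a : set (borel_config A)).
Proof. by apply: sub_sigma_algebra; exact: open_cylinder. Qed.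

(** Measurability can be tested letter by letter. *)
Lemma measurable_fun_config d (T : measurableType d) (f : T -> config A) :
  (forall n l, measurable [set t | f t n = l]) ->
  measurable_fun setT (f : T -> borel_config A).
Proof.
move=> mf; apply: (measurability cylinders borel_cylinders).
move=> _ [_ [->|[a ->]] <-]; first by rewrite preimage_set0 setI0.
rewrite setTI cylinder_bigcap preimage_bigcap bigcap_fset.
apply: bigsetI_measurable => n _; rewrite /preimage/=.
case: a.[? n]%fmap => [l|]; last first.
  by rewrite (_ : [set _ | _] = set0) //; apply/seteqP; split.
have := mf n l; congr measurable.
by apply/seteqP; split=> t /= => [<-|[]].
Qed.

Lemma measurable_shift n :
  measurable_fun setT (shift n : borel_config A -> borel_config A).
Proof.
apply: measurable_fun_config => m l.
apply: sub_sigma_algebra; have := open_letter (m + n) (Some l).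
by congr open; apply/seteqP; split=> x /= => [[]|<-].
Qed.

(** Together with the empty set, the cylinders form a pi-system. *)
Lemma eq_measure_cylinder (R : realType)
    (m1 m2 : {measure set (borel_config A) -> \bar R}) :
  (m1 setT < +oo)%E ->
  (forall a, m1 (cylinder a) = m2 (cylinder a)) ->
  forall E, measurable E -> m1 E = m2 E.
Proof.
move=> m1oo m12 E; rewrite borel_cylinders => mE.
have cylT : cylinder [fmap]%fmap = [set: config A].
  by apply/seteqP; split=> // x _; apply/cylinderP => n; rewrite inE.
apply: (@g_sigma_algebra_measure_unique _ _ _ cylinders _ (fun=> setT)) => //.
- by move=> F [->|[a ->]]; [exact: measurable0|exact: measurable_cylinder].
- by move=> _; right; exists [fmap]%fmap; rewrite cylT.
- by apply/seteqP; split=> // x _; exists 0%N.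
- move=> E1 E2 [->|[a ->]]; first by rewrite set0I; left.
  case=> [->|[b ->]]; first by rewrite setI0; left.
  have [/set0P[x [xa xb]]|/negP/negPn/eqP ->] :=
    pselect (cylinder a `&` cylinder b != set0); last by left.
  by right; eexists; exact: cylinderI xa xb.
- by move=> F [->|[a ->]]; rewrite ?measure0.
Qed.

End Cylinders.

(** * Independent coins from a uniform point *)

Section Coins.
Context {R : realType}.
Implicit Types (p : nat -> R) (u : R) (v : nat -> bool).

(** The digits of a point of the unit interval for which independent Bernoulli
    variables of parameters [p] come out: the first digit tells on which side of
    [p 0] the point lies, the next ones are the digits of its relative position
    on that side. *)
Fixpoint bit p (k : nat) u : bool :=
  if k is k'.+1 then
    bit (p \o S) k' (if u < p 0%N then u / p 0%N else (u - p 0%N) / (1 - p 0%N))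
  else u < p 0%N.

Lemma measurable_bit p k : measurable_fun setT (bit p k).
Proof.
elim: k p => [|k IH] p /=.
  by apply: measurable_fun_ltr => //; exact: measurable_cst.
apply: (@measurableT_comp _ _ _ _ _ _ (bit (p \o S) k)) => //.
apply: measurable_fun_ifT => /=.
- by apply: measurable_fun_ltr => //; exact: measurable_cst.
- exact: measurable_funM.
- by apply: measurable_funM => //; exact: measurable_funB.
Qed.

Definition coin_weight (r : R) (b : bool) : R := if b then r else 1 - r.

(** The points with given first digits are obtained from those with the shifted
    digits by an affine map, onto the left or the right side of [p 0]; so they
    form an interval, and its length is multiplied at each step. *)
Lemma bits_interval p (N : nat) v : (forall k, 0 < p k < 1) ->
  let w := \prod_(i < N) coin_weight (p i) (v i) in
  exists a : R, [/\ 0 <= a, a + w <= 1, 0 <= w &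
    [set u | 0 <= u < 1 /\ forall i, (i < N)%N -> bit p i u = v i] =
    `[a, a + w[%classic].
Proof.
elim: N p v => [|N IH] p v p01 /=.
  exists 0; rewrite big_ord0 add0r; split=> //; apply/seteqP; split=> u /=.
    by rewrite in_itv /=; case.
  by rewrite in_itv.
have [a [a0 aw w0 E]] := IH (p \o S) (v \o S) (fun k => p01 k.+1).
rewrite big_ord_recl
  (eq_bigr (fun i : 'I_N => coin_weight ((p \o S) i) ((v \o S) i))) //.
set w := \prod_(i < N) _ in w0 aw E *.
have {}p01 := p01 0%N; set q := p 0%N in p01 *.
have mem u : (0 <= u < 1 /\ forall i, (i < N)%N -> bit (p \o S) i u = v i.+1) <->
    a <= u < a + w.
  have /seteqP[h1 h2] := E.
  by split=> [/h1|H]; [rewrite /= in_itv|apply: h2; rewrite /= in_itv].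
have split_bits u : 0 <= u < 1 ->
    (forall i, (i < N.+1)%N -> bit p i u = v i) <-> (u < q) = v 0%N /\
    forall i, (i < N)%N -> bit (p \o S) i
       (if u < q then u / q else (u - q) / (1 - q)) = v i.+1.
  move=> u01; split=> [H|[H0 H1] [|i] //= iN]; last exact: H1.
  by split=> [|i iN]; [exact: (H 0%N)|exact: (H i.+1)].
have q0 : 0 < q by lra.
have q1 : 0 < 1 - q by lra.
exists (if v 0%N then q * a else q + (1 - q) * a).
rewrite /coin_weight; case v0 : (v 0%N).
  split; [by nra|by nra|by nra|apply/seteqP; split=> u /=; rewrite in_itv /=].
    move=> [u01 /(split_bits _ u01)[+ H]]; rewrite v0 => uq; rewrite uq in H.
    have /mem : 0 <= u / q < 1 /\
        forall i, (i < N)%N -> bit (p \o S) i (u / q) = v i.+1.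
      split=> //; rewrite divr_ge0 ?ltr_pdivrMr ?mul1r //=; lra.
    by rewrite ler_pdivlMr // ltr_pdivrMr // mulrC -mulrDr [q * (a + w)]mulrC.
  move=> uaw; have u01 : 0 <= u < 1 by nra.
  have uq : u < q by nra.
  split=> //; apply/split_bits => //; rewrite v0 uq; split=> //.
  have /mem[] // : a <= u / q < a + w.
  by rewrite ler_pdivlMr // ltr_pdivrMr // mulrC [(a + w) * q]mulrC mulrDr.
split; [by nra|by nra|by nra|apply/seteqP; split=> u /=; rewrite in_itv /=].
  move=> [u01 /(split_bits _ u01)[+ H]]; rewrite v0 => uq; rewrite uq in H.
  have {}uq : q <= u by rewrite leNgt uq.
  have /mem : 0 <= (u - q) / (1 - q) < 1 /\
      forall i, (i < N)%N -> bit (p \o S) i ((u - q) / (1 - q)) = v i.+1.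
    split=> //; rewrite divr_ge0 ?ltr_pdivrMr ?mul1r //=; lra.
  by rewrite ler_pdivlMr // ltr_pdivrMr //; lra.
move=> uaw; have uq : q <= u by nra.
have u01 : 0 <= u < 1 by nra.
have {}uq : (u < q) = false by rewrite ltNge uq.
split=> //; apply/split_bits => //; rewrite v0 uq; split=> //.
have /mem[] // : a <= (u - q) / (1 - q) < a + w.
by rewrite ler_pdivlMr // ltr_pdivrMr //; lra.
Qed.

Lemma measurable_eq_bit p k b : measurable [set u | bit p k u = b].
Proof.
rewrite -[X in measurable X]setTI.
apply: (measurable_bit p k measurableT (Y := [set b])).
by [].
Qed.

Lemma measurable_bits p (N : nat) (Q : pred nat) v :
  measurable [set u | forall i, (i < N)%N -> Q i -> bit p i u = v i].
Proof.
rewrite (_ : [set _ | _] =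
    \big[setI/setT]_(i < N | Q i) [set u | bit p i u = v i]).
  apply: bigsetI_measurable => i _; exact: measurable_eq_bit.
apply/seteqP; split=> u /=.
  by move=> H; elim/big_ind : _ => // i Qi; exact: H.
move=> + i iN Qi; rewrite (bigD1 (Ordinal iN)) //= => -[]//.
Qed.

Definition unit_interval : set (measurableTypeR R) -> \bar R :=
  mrestr (@lebesgue_measure R) (measurable_itv `[(0 : R), 1[).

HB.instance Definition _ := Measure.on unit_interval.

Lemma unit_intervalT : unit_interval setT = 1%E.
Proof.
by rewrite /unit_interval /= /mrestr setTI lebesgue_measure_itv /= lte01 sube0.
Qed.

HB.instance Definition _ :=
  Measure_isProbability.Build _ _ _ unit_interval unit_intervalT.

(** When every digit is prescribed this is the length of an interval.  A digit
    is then released by summing over its two values, whose weights add up to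
    one; [j] bounds the positions of the released digits. *)
Lemma unit_interval_bits p (N : nat) (Q : pred nat) v :
  (forall k, 0 < p k < 1) ->
  unit_interval [set u | forall i, (i < N)%N -> Q i -> bit p i u = v i] =
  (\prod_(i < N | Q i) coin_weight (p i) (v i))%:E.
Proof.
move=> p01.
have extend (Q1 Q2 : pred nat) v1 : (forall i, (i < N)%N -> Q1 i = Q2 i) ->
    unit_interval [set u | forall i, (i < N)%N -> Q1 i -> bit p i u = v1 i] =
      (\prod_(i < N | Q1 i) coin_weight (p i) (v1 i))%:E ->
    unit_interval [set u | forall i, (i < N)%N -> Q2 i -> bit p i u = v1 i] =
      (\prod_(i < N | Q2 i) coin_weight (p i) (v1 i))%:E.
  move=> Q12; rewrite (eq_bigl (fun i : 'I_N => Q2 i)) => [<-|i]; last exact: Q12.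
  congr (unit_interval _); apply/seteqP; split=> u /= H i iN;
    by move=> Qi; apply: H; rewrite ?Q12 // -Q12.
suff H j (Q' : pred nat) v' : (forall i, (j <= i)%N -> Q' i) ->
  unit_interval [set u | forall i, (i < N)%N -> Q' i -> bit p i u = v' i] =
  (\prod_(i < N | Q' i) coin_weight (p i) (v' i))%:E.
  apply: (extend (fun i => Q i || (N <= i)%N)).
    by move=> i iN; rewrite leqNgt iN orbF.
  by apply: (H N) => i ->; rewrite orbT.
elim: j Q' v' => [|j IH] Q' v' Q'j.
  have [a [a0 aw w0 E]] := bits_interval N v' p01.
  apply: (extend predT) => [i _|]; first by rewrite Q'j.
  rewrite /unit_interval /= /mrestr.
  rewrite (_ : _ `&` _ = `[a, a + \prod_(i < N) coin_weight (p i) (v' i)[%classic).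
    rewrite lebesgue_measure_itv /= lte_fin ltrDl.
    case: ltP => w1; first by rewrite -EFinB addrAC subrr add0r.
    by congr EFin; apply/eqP; rewrite eq_le w0.
  rewrite -E; apply/seteqP; split=> u /=; rewrite in_itv /=.
    by move=> [H u01]; split=> // i iN; exact: H.
  by move=> [u01 H]; split=> // i iN _; exact: H.
have [Qj|nQj] := boolP (Q' j).
  by apply: IH => i; rewrite leq_eqVlt => /orP[/eqP <-|/Q'j].
pose Q2 i := (i == j) || Q' i.
have Q2j i : (j <= i)%N -> Q2 i.
  by rewrite leq_eqVlt eq_sym => /orP[|/Q'j]; rewrite /Q2 => ->; rewrite ?orbT.
have [jN|Nj] := ltnP j N; last first.
  apply: (extend Q2); last exact: IH.
  by move=> i iN; rewrite /Q2 ltn_eqF // (leq_trans iN).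
pose v2 b i := if i == j then b else v' i.
rewrite (_ : [set u | _] =
    [set u | forall i, (i < N)%N -> Q2 i -> bit p i u = v2 true i] `|`
    [set u | forall i, (i < N)%N -> Q2 i -> bit p i u = v2 false i]); last first.
  apply/seteqP; split=> u /=.
    move=> H; have [bj|bj] := boolP (bit p j u); [left|right] => i iN;
      rewrite /Q2 /v2; case: eqP => [->|_ /H]; rewrite ?bj //= ?(negbTE bj) //; exact.
  by move=> [] H i iN Qi; have := H i iN; rewrite /Q2 /v2 Qi orbT => ->//;
    case: eqP Qi nQj => // -> ->.
rewrite measureU; last 3 first.
- exact: measurable_bits.
- exact: measurable_bits.
- apply/seteqP; split=> // u /= [/(_ j jN) + /(_ j jN)].
  by rewrite /Q2 /v2 eqxx /= => -> // /(_ isT).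
pose w b := \prod_(i < N | Q2 i) coin_weight (p i) (v2 b i).
transitivity ((w true)%:E + (w false)%:E)%E.
  by congr (_ + _)%E; exact: IH.
rewrite -EFinD; congr EFin.
have split_j b : \prod_(i < N | Q2 i) coin_weight (p i) (v2 b i) =
    coin_weight (p j) b * \prod_(i < N | Q' i) coin_weight (p i) (v' i).
  rewrite (bigD1 (Ordinal jN)) /=; last by rewrite /Q2 eqxx.
  rewrite /v2 eqxx; congr *%R; apply: eq_big => [i|i /andP[_]].
    rewrite /Q2 -val_eqE /=; case: eqP => [->|_] /=; first by rewrite (negbTE nQj).
    by rewrite andbT.
  by rewrite -val_eqE /= => /negbTE ->.
by rewrite /w !split_j -mulrDl /coin_weight addrC subrK mul1r.
Qed.

(** Positions of the enumeration that carry no index receive the parameter 1/2,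
    so that all parameters lie strictly between 0 and 1. *)
Definition coin (T : countType) (r : T -> R) (u : R) (t : T) : bool :=
  bit (fun k => oapp r 2^-1 (choice.unpickle k)) (choice.pickle t) u.

Lemma measurable_coin (T : countType) (r : T -> R) (t : T) (b : bool) :
  measurable [set u | coin r u t = b].
Proof. exact: measurable_eq_bit. Qed.

Lemma unit_interval_coins (T : countType) (r : T -> R) (D : {fset T})
    (v : T -> bool) : (forall t, 0 < r t < 1) ->
  unit_interval [set u | forall t, t \in D -> coin r u t = v t] =
  (\prod_(t <- D) coin_weight (r t) (v t))%:E.
Proof.
move=> r01; pose p k := oapp r 2^-1 (choice.unpickle k).
have p01 k : 0 < p k < 1.
  by rewrite /p; case: choice.unpickle => //= ; apply/andP; split; lra.
pose K : seq nat := [seq choice.pickle t | t <- D].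
pose N := (\max_(t <- D) choice.pickle t).+1.
have KN t : t \in D -> (choice.pickle t < N)%N.
  by move=> tD; rewrite ltnS (big_rem t) //= leq_maxl.
pose w k := oapp v true (choice.unpickle k).
have -> : [set u | forall t, t \in D -> coin r u t = v t] =
    [set u | forall i, (i < N)%N -> i \in K -> bit p i u = w i].
  apply/seteqP; split=> u /= H.
    by move=> i iN /mapP[t tD it]; rewrite it [LHS]H // /w choice.pickleK.
  move=> t tD; transitivity (w (choice.pickle t)).
    by apply: H; [exact: KN|exact: map_f].
  by rewrite /w choice.pickleK.
rewrite (unit_interval_bits _ (fun i => i \in K)) //; congr EFin.
have -> : \prod_(t <- D) coin_weight (r t) (v t) =
    \prod_(k <- K) coin_weight (p k) (w k).
  by rewrite big_map; apply: eq_bigr => t _; rewrite /p /w choice.pickleK.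
rewrite -(big_mkord (fun i => i \in K) (fun k => coin_weight (p k) (w k))).
rewrite -big_filter; apply: perm_big; apply: uniq_perm.
- by rewrite filter_uniq // iota_uniq.
- by rewrite map_inj_uniq ?fset_uniq //; exact: pcan_inj choice.pickleK.
- move=> i; rewrite mem_filter mem_index_iota /=.
  by case: (boolP (i \in K)) => //= /mapP[t tD ->]; exact: KN.
Qed.

End Coins.

(** * From cocycles to Markov random fields *)

(** An edge that meets [F] lies in [F] and its boundary, where the glued point
    is [y]; any other edge lies off [F], where it is [x]. *)
Lemma sft_glue (A : finPointedType) (X : set (config A)) (F : {fset site})
    (x y : config A) : is_nn_sft X -> X x -> X y ->
  (forall n, n \in boundary F -> x n = y n) ->
  X (fun n => if n \in F then y n else x n).
Proof.
move=> [forbid adj ->] Xx Xy xy a k fa; rewrite /cylinder /= => ak.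
have [n [m [nm dom_a]]] := adj _ fa; rewrite dom_a in ak.
have na : n \in [fset n; m]%fset by rewrite !inE eqxx.
have ma : m \in [fset n; m]%fset by rewrite !inE eqxx orbT.
have adj_k : adjacent (n + k) (m + k) by rewrite /adjacent opprD addrACA subrr addr0.
have adj_k' : adjacent (m + k) (n + k).
  move: adj_k; rewrite /adjacent /norm1.
  by case: (n) (m) (k) => [? ?] [? ?] [? ?] /=; lia.
have nbr u v : adjacent u v -> u \in F -> (if v \in F then y v else x v) = y v.
  move=> uv uF; case: ifPn => // vF; apply: xy; rewrite in_boundary vF.
  by apply/hasP; exists u.
have [inF|] := boolP ((n + k \in F) || (m + k \in F)).
  apply: (Xy a k fa); rewrite /cylinder /= dom_a -ak; apply/eq_restrict => i.
  rewrite /shift !inE => /orP[]/eqP ->; case/orP: inF => [nF|mF].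
  - by rewrite nF.
  - by rewrite (nbr _ _ adj_k' mF).
  - by rewrite (nbr _ _ adj_k nF).
  - by rewrite mF.
rewrite negb_or => /andP[nF mF]; apply: (Xx a k fa).
rewrite /cylinder /= dom_a -ak; apply/eq_restrict => i.
by rewrite /shift !inE => /orP[]/eqP ->; rewrite ?(negbTE nF) ?(negbTE mF).
Qed.

Lemma sft_shift (A : finPointedType) (X : set (config A)) v x :
  is_nn_sft X -> X x -> X (shift v x).
Proof.
move=> [forbid _ ->] Xx a n fa ax; apply: (Xx a (n + v) fa).
rewrite (_ : shift (n + v) x = shift n (shift v x)) //.
by apply/funext => m; rewrite /shift addrA.
Qed.

Section Support.
Context {A : finPointedType} {R : realType}.
Variable mu : probability (borel_config A) R.

(** The complement of the support is covered by null cylinders, of which there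
    are countably many. *)
Lemma cylinder_meets_support (a : pattern A) :
  (0 < mu (cylinder a))%E -> exists2 x, msupport mu x & cylinder a x.
Proof.
move=> a0; apply: contrapT => /forall2NP noX.
pose F k : set (borel_config A) := if choice.unpickle k is Some b then
  (if mu (cylinder b) == 0%E then cylinder b else set0) else set0.
have F0 k : mu.-negligible (F k).
  rewrite /F; case: choice.unpickle => [b|]; last exact: negligible_set0.
  case: eqP => [b0|_]; last exact: negligible_set0.
  by exists (cylinder b); split=> //; exact: measurable_cylinder.
have /negligible_bigcup UF := F0.
suff : mu (cylinder a) = 0%E by move=> a0'; rewrite a0' ltxx in a0.
apply/measure_negligible; first exact: measurable_cylinder.
apply: negligibleS UF => x ax.
have [/existsNP[U /not_implyP[oU /not_implyP[Ux U0]]]|//] := noX x.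
have [W WU] := open_sub_cylinder oU Ux.
exists (choice.pickle (restrict x W)) => //; rewrite /F choice.pickleK.
case: eqP => [_|[]]; first exact/cylinder_restrict.
apply/eqP; rewrite eq_le measure_ge0 andbT leNgt; apply/negP => W0.
apply: U0; apply: lt_le_trans W0 _; apply: le_measure => //; rewrite inE.
  exact: measurable_cylinder.
exact: sub_sigma_algebra.
Qed.

Lemma support_cylinder x W : msupport mu x -> (0 < mu (cylinder (restrict x W)))%E.
Proof.
by apply; [exact: open_cylinder|exact/cylinder_restrict].
Qed.

End Support.

Lemma fset_diff_sites (A : finPointedType) (X : set (config A)) x y n :
  asymptotic_pair X x y -> (n \in diff_sites x y) = (x n != y n).
Proof.
by case=> _ _ fin; rewrite in_fset_set //; apply/idP/idP; rewrite inE /= => /eqP.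
Qed.

Lemma mem_diff_sites (A : finPointedType) (X : set (config A)) x y n :
  asymptotic_pair X x y -> x n <> y n -> n \in diff_sites x y.
Proof. by move=> xy xyn; rewrite (fset_diff_sites _ xy); apply/eqP. Qed.

Lemma boundary_sub (F G : {fset site}) n : (F `<=` G)%fset ->
  n \in boundary F -> n \in (G `|` boundary G)%fset.
Proof.
move=> /fsubsetP FG; rewrite in_fsetU !in_boundary => /andP[_ /hasP[m mF mn]].
by case: (boolP (n \in G)) => //= _; apply/hasP; exists m => //; exact: FG.
Qed.

(** Write [D] for the domain of [a], and condition on [c], which is either [b]
    or its restriction to the boundary of [D].  The patterns on [D] that are
    compatible with [c] are the same in both cases, by glueing, and their
    probabilities relative to that of [a] are the exponentials of the same
    values of the cocycle.  Summing over these patterns determines the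
    conditional probability of [a]. *)
Lemma corresponds_mrf (A : finPointedType) (R : realType) (X : set (config A))
    (mu : probability (borel_config A) R) (M : pair_fun A R) :
  is_nn_sft X -> msupport mu = X -> corresponds X mu M -> is_mrf mu.
Proof.
move=> sftX suppX corr a b bdb dab b0.
pose D := domf a; pose b' := (b.[& boundary D])%fmap.
have dom_b' : domf b' = boundary D.
  by apply/fsetP => n; rewrite mem_restrictf andb_idr // => /(fsubsetP bdb).
have bb' x : cylinder b x -> cylinder b' x.
  move=> /cylinderP bx; apply/cylinderP => n nb'.
  have nD : n \in boundary D by rewrite -dom_b'.
  by rewrite fnd_restrict nD bx // (fsubsetP bdb).
have [x0] := cylinder_meets_support b0; rewrite suppX => Xx0 bx0.
(* All points are completed outside D by one fixed point x0 of the cylinder b,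
   so that the values of the cocycle do not depend on c. *)
pose glue (y : config A) : config A := fun n => if n \in D then y n else x0 n.
have glueP y : X y -> cylinder b' y -> [/\ X (glue y),
    (forall n, n \in D -> glue y n = y n), cylinder b (glue y) &
    cylinder b' (glue y)].
  move=> Xy b'y; have b_glue : cylinder b (glue y).
    apply/cylinderP => n nb; rewrite /glue ifN; first by move/cylinderP: bx0; exact.
    by move/fdisjointP: dab => /(_ n) /contraL -> //.
  split=> //; last exact: bb'.
    apply: sft_glue => // n nD; have /bb' /cylinderP/(_ n) := bx0.
    have nb' : n \in domf b' by rewrite dom_b'.
    by move/cylinderP/(_ n nb'): b'y => -> /(_ nb') [].
  by move=> n nD; rewrite /glue nD.
pose ok c := [/\ (boundary D `<=` domf c)%fset,
  forall x, cylinder c x -> cylinder b' x &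
  forall z, X z -> cylinder b' z -> cylinder c (glue z)].
have ok_b : ok b by split=> // z Xz /glueP[].
have ok_b' : ok b' by split=> // [|z Xz /glueP[]//]; rewrite dom_b'.
have asym y z : X y -> X z -> cylinder b' y -> cylinder b' z ->
    asymptotic_pair X (glue y) (glue z).
  move=> Xy Xz /(glueP _ Xy)[Xgy _ _ _] /(glueP _ Xz)[Xgz _ _ _]; split=> //.
  apply: (sub_finite_set _ (finite_fset D)) => n /=; rewrite /glue.
  by case: ifP.
have fin_mu a1 a2 : mu (cylinder a1 `&` cylinder a2) \is a fin_num.
  by apply: fin_num_measure; apply: measurableI; exact: measurable_cylinder.
have ratio c y z : ok c -> X y -> X z -> cylinder b' y -> cylinder b' z ->
    0 < fine (mu (cylinder (restrict y D) `&` cylinder c)) /\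
    fine (mu (cylinder (restrict z D) `&` cylinder c)) =
    expR (M (glue y) (glue z)) * fine (mu (cylinder (restrict y D) `&` cylinder c)).
  move=> [bdc _ gc] Xy Xz b'y b'z.
  have cylE x : X x -> cylinder b' x -> cylinder (restrict x D) `&` cylinder c =
      cylinder (restrict (glue x) (D `|` domf c)%fset).
    move=> Xx b'x; rewrite (@cylinderI _ _ _ (glue x)) //; last exact: gc.
    by have [_ gx _ _] := glueP _ Xx b'x; apply/cylinder_restrict.
  have mu_gt0 x : X x -> cylinder b' x ->
      0 < fine (mu (cylinder (restrict x D) `&` cylinder c)).
    move=> Xx b'x; apply: fine_gt0; rewrite -ge0_fin_numE // fin_mu andbT.
    rewrite cylE //; apply: support_cylinder; rewrite suppX.
    by have [] := glueP _ Xx b'x.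
  split; first exact: mu_gt0.
  have yz := asym _ _ Xy Xz b'y b'z.
  have diffD : (diff_sites (glue y) (glue z) `<=` D)%fset.
    apply/fsubsetP => n; rewrite (fset_diff_sites _ yz) /glue.
    by case: ifP => //; rewrite eqxx.
  rewrite -(corr _ _ (D `|` domf c)%fset yz).
    by rewrite -!cylE // divfK // gt_eqF // mu_gt0.
  apply/fsubsetP => n; rewrite in_fsetU => /orP[nd|nd].
    by rewrite in_fsetU (fsubsetP diffD).
  have := boundary_sub diffD nd; rewrite !in_fsetU => /orP[->//|/(fsubsetP bdc) ->].
  by rewrite orbT.
have null a1 c : ok c -> (forall z, X z -> cylinder b' z -> ~ cylinder a1 z) ->
    mu (cylinder a1 `&` cylinder c) = 0%E.
  move=> [_ cb' _] noz; apply/eqP; rewrite eq_le measure_ge0 andbT leNgt.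
  apply/negP => a1c.
  have [x [a1x cx]] : (cylinder a1 `&` cylinder c) !=set0.
    by apply/set0P/eqP => E; rewrite E measure0 ltxx in a1c.
  rewrite (cylinderI a1x cx) in a1c.
  have [z] := cylinder_meets_support a1c; rewrite suppX => Xz.
  rewrite -(cylinderI a1x cx) => -[a1z cz]; exact: noz (cb' _ cz) a1z.
rewrite /cond_prob -/b' -/D.
have [[ya [Xya b'ya aya]]|noy] :=
  pselect (exists y, [/\ X y, cylinder b' y & cylinder a y]);
  last by rewrite !null //= ?mul0r // => z Xz b'z az; apply: noy; exists z.
have Ea : cylinder a = cylinder (restrict ya D) by congr cylinder; rewrite -[LHS]aya.
pose pat (g : {ffun D -> A}) : pattern A := [fmap n : D => g n]%fmap.
pose hit (g : {ffun D -> A}) z := [/\ X z, cylinder b' z & cylinder (pat g) z].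
(* The probability of the pattern g relative to that of a, which is 0 when g is
   incompatible with the boundary. *)
pose e g := if pselect (exists z, hit g z) is left h
  then expR (M (glue ya) (glue (projT1 (cid h)))) else 0.
have total c : ok c -> mu (cylinder c) =
    ((\sum_(g \in [set: {ffun D -> A}]) e g) *
      fine (mu (cylinder a `&` cylinder c)))%:E.
  move=> okc; rewrite [X in mu X = _](_ : cylinder c =
      \bigcup_(g in [set: {ffun D -> A}]) (cylinder (pat g) `&` cylinder c)); last first.
    apply/seteqP; split=> [x cx|x [g _ []]//].
    exists [ffun n : D => x (val n)] => //; split=> //.
    by apply/cylinderP => n nD; rewrite in_fnd /= !ffunE.
  rewrite measure_fin_bigcup; last 3 first.
  - exact: finite_finset.
  - move=> g h _ _ [x [[/cylinderP xg _] [/cylinderP xh _]]].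
    apply/ffunP => n; have := etrans (xg _ (valP n)) (esym (xh _ (valP n))).
    by rewrite -!Some_fnd !ffunE => -[].
  - by move=> g _; apply: measurableI; exact: measurable_cylinder.
  rewrite mulr_fsuml -fsumEFin; last exact: finite_finset.
  apply: eq_fsbigr => g _; rewrite /e; case: pselect => [h|noz].
    case: cid => z [Xz b'z gz] /=.
    have [_] := ratio c ya z okc Xya Xz b'ya b'z.
    rewrite -Ea => <-; rewrite -[pat g]gz fineK //; exact: fin_mu.
  by rewrite mul0r; apply: null => // z Xz b'z gz; apply: noz; exists z.
have main c : ok c -> fine (mu (cylinder a `&` cylinder c)) / fine (mu (cylinder c)) =
    (\sum_(g \in [set: {ffun D -> A}]) e g)^-1.
  move=> okc; have [t0 _] := ratio c ya ya okc Xya Xya b'ya b'ya.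
  rewrite total //=; rewrite -Ea in t0.
  by rewrite invfM mulrCA mulfV ?mulr1 // gt_eqF.
by rewrite !main.
Qed.

(** * Growth of Gibbs cocycles *)

Section FiniteRange.
Context {A : finPointedType} {R : realType} {X : set (config A)}.
Variable phi : pattern A -> R.
Hypotheses (sftX : is_nn_sft X) (invphi : shift_inv_interaction X phi).

Definition box (k : nat) : {fset site} :=
  [fset ((a%:Z - k%:Z, b%:Z - k%:Z) : site) |
    a in iota 0 (2 * k).+1, b in iota 0 (2 * k).+1]%fset.

Lemma mem_box k (n : site) : (norm1 n <= k)%N -> n \in box k.
Proof.
case: n => i j; rewrite /norm1 /= => ijk; apply/imfset2P.
have in_iota (l : int) : (absz l <= k)%N -> absz (l + k%:Z)%R \in iota 0 (2 * k).+1.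
  by rewrite mem_iota; lia.
exists (absz (i + k%:Z)%R); first by apply: in_iota; lia.
exists (absz (j + k%:Z)%R); first by apply: in_iota; lia.
by congr (_, _); lia.
Qed.

Definition extend (B : {fset site}) (g : {ffun B -> A}) : config A :=
  fun m => if insub m is Some b then g b else point.

(** A bound for the interaction on all windows inside [B]: the sum of its
    absolute values over the finitely many patterns on such windows. *)
Definition interaction_bound (B : {fset site}) : R :=
  \sum_(V <- fpowerset B) \sum_(g : {ffun B -> A}) `|phi (restrict (extend g) V)|.

Lemma interaction_bound_ge0 B : 0 <= interaction_bound B.
Proof. by apply: sumr_ge0 => V _; apply: sumr_ge0. Qed.

Lemma le_interaction_bound_box B (V : {fset site}) x : (V `<=` B)%fset ->
  `|phi (restrict x V)| <= interaction_bound B.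
Proof.
move=> VB; rewrite /interaction_bound (big_fsetD1 V) ?fpowersetE //=.
rewrite ler_wpDr //; first by apply: sumr_ge0 => W _; apply: sumr_ge0.
pose g : {ffun B -> A} := [ffun b => x (val b)].
rewrite (bigD1 g) //= (_ : restrict x V = restrict (extend g) V).
  by rewrite ler_wpDr //; apply: sumr_ge0.
apply/eq_restrict => n /(fsubsetP VB) nB; rewrite /extend.
by case: insubP => [b _ <-|]; [rewrite ffunE|rewrite nB].
Qed.

Definition translate (W : {fset site}) (n : site) : {fset site} :=
  [fset (m + n)%R | m in W]%fset.

Lemma mem_translate W n m : (m \in translate W n) = (m - n \in W).
Proof.
apply/imfsetP/idP => [[k /= kW ->]|mW]; first by rewrite addrK.
by exists (m - n); rewrite ?subrK.
Qed.

Lemma translate_box W n k : n \in W -> (diameter W <= k)%N ->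
  (translate W (- n) `<=` box k)%fset.
Proof.
move=> nW Wk; apply/fsubsetP => m; rewrite mem_translate opprK => mnW.
apply: mem_box; apply: leq_trans Wk; rewrite /diameter (big_rem (m + n)) //=.
by rewrite leq_max (big_rem n) //= leq_max addrK leqnn.
Qed.

(** A window of bounded diameter can be translated into a fixed box. *)
Lemma le_interaction_bound x W n k : X x -> n \in W -> (diameter W <= k)%N ->
  `|phi (restrict x W)| <= interaction_bound (box k).
Proof.
move=> Xx nW Wk.
have -> : phi (restrict x W) = phi (restrict (shift n x) (translate W (- n))).
  apply: invphi; first by exists x, W.
    by exists (shift n x), (translate W (- n)); split=> //; exact: sft_shift.
  by exists n => m; rewrite !fnd_restrict_config mem_translate opprK.
exact/le_interaction_bound_box/translate_box.
Qed.

(** A window contributes only if it has bounded diameter and contains a site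
    where the two points differ.  Up to translation by such a site it is one of
    the subsets of a box. *)
Lemma gibbs_cocycle_le : finite_range X phi -> exists C : R,
  forall x y, asymptotic_pair X x y ->
  `|gibbs_cocycle phi x y| <= C * #|` diff_sites x y|%:R.
Proof.
move=> [k range]; pose c := interaction_bound (box k).
have c0 : 0 <= c := interaction_bound_ge0 _.
exists ((c + c) * #|` fpowerset (box k)|%:R) => x y xy; have [Xx Xy _] := xy.
pose s := [seq translate V n | n <- diff_sites x y, V <- fpowerset (box k)].
pose S : {fset {fset site}} := [fset W in s]%fset.
pose f W := phi (restrict y W) - phi (restrict x W).
have supp W : f W != 0 -> W \in S /\ `|f W| <= c + c.
  move=> fW; have Wk : (diameter W <= k)%N.
    rewrite leqNgt; apply/negP => Wk; move: fW.
    by rewrite /f !range ?subrr ?eqxx //; [exists x, W|exists y, W].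
  have [n nW xyn] : exists2 n, n \in W & x n <> y n.
    apply: contrapT => /forall2NP same; move/eqP: fW; apply.
    rewrite /f (_ : restrict y W = restrict x W) ?subrr //.
    by apply/eq_restrict => n nW; have [//|/contrapT] := same n.
  split; last first.
    by apply: le_trans (ler_normB _ _) _; apply: lerD; exact: le_interaction_bound nW Wk.
  rewrite in_fset; apply/allpairsP; exists (n, translate W (- n)); split=> /=.
  - exact: (mem_diff_sites xy).
  - by rewrite fpowersetE translate_box.
  - by apply/fsetP => m; rewrite !mem_translate opprK subrK.
have cardS : (#|` S| <= #|` diff_sites x y| * #|` fpowerset (box k)|)%N.
  by rewrite /S card_fseq (leq_trans (size_undup _)) // size_allpairs.
rewrite /gibbs_cocycle (fsbigTE S) => [|W /negP WS]; last first.
  by apply/eqP; apply: contraT => /supp[].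
apply: le_trans (ler_norm_sum _ _ _) _.
apply: (@le_trans _ _ (\sum_(W <- S) (c + c))).
  apply: ler_sum => W _; have [E|/supp[]//] := eqVneq (f W) 0.
  by rewrite -/(f W) E normr0 addr_ge0.
rewrite big_const_seq count_predT iter_addr_0 -[X in X <= _]mulr_natr -mulrA.
apply: ler_wpM2l; first exact: addr_ge0.
by rewrite -natrM ler_nat mulnC.
Qed.
End FiniteRange.

(** * Extending an independent family of cocycles to a basis *)

Section Basis.
Context {A : finPointedType} {R : realType}.
Variable X : set (config A).
Implicit Types (S T : set (pair_fun A R)).

Definition dependency (k : nat) (v : 'I_k -> pair_fun A R) (c : 'I_k -> R) : Prop :=
  forall x y, asymptotic_pair X x y -> \sum_j c j * v j x y = 0.

Definition independent S : Prop :=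
  forall (k : nat) (v : 'I_k -> pair_fun A R) (c : 'I_k -> R), injective v ->
    (forall j, S (v j)) -> dependency v c -> forall j, c j = 0.

Lemma independent_range (I : Type) (M : I -> pair_fun A R) :
  linearly_independent X M -> independent (range M).
Proof.
move=> indM k v c injv vM rel.
have /choice[i iP] j : exists i, M i = v j by have [i _ <-] := vM j; exists i.
apply: (indM k i c) => [j j' ij|x y xy]; first by apply: injv; rewrite -!iP ij.
by rewrite -[RHS](rel x y xy); apply: eq_bigr => j _; rewrite iP.
Qed.

(** Finitely many elements of the union of a chain lie in one of its members. *)
Lemma independent_bigcup (S0 : set (pair_fun A R)) (F : set (set (pair_fun A R))) :
  independent S0 -> (forall T, F T -> independent (T `|` S0)) ->
  total_on F subset -> independent ((\bigcup_(T in F) T) `|` S0).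
Proof.
move=> indS0 indF totF k v c injv vF.
suff [T indT vT] : exists2 T, independent T & forall j, T (v j) by exact: indT.
suff [T TF vT] : exists2 T, T = set0 \/ F T &
    forall j, j \in enum 'I_k -> (T `|` S0) (v j).
  exists (T `|` S0) => [|j]; last by apply: vT; rewrite mem_enum.
  by case: TF => [->|/indF//]; rewrite set0U.
elim: (enum 'I_k) => [|j s [T TF vT]]; first by exists set0; [left|].
have [[T' FT' T'v]|S0v] := vF j; last first.
  by exists T => // i; rewrite inE => /orP[/eqP ->|/vT//]; right.
have [TT'|T'T] : T `<=` T' \/ T' `<=` T.
- by case: TF => [->|FT]; [left|exact: totF].
- exists T'; first by right.
  move=> i; rewrite inE => /orP[/eqP ->|/vT[/TT'|]]; by [left|right].
- exists T => // i; rewrite inE => /orP[/eqP ->|/vT//]; by left; exact: T'T.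
Qed.

(** In a dependency that involves [M] the coefficient of [M] is nonzero, since
    the other elements are independent. *)
Lemma dependent_span S (M : pair_fun A R) : independent S ->
  ~ S M -> ~ independent (S `|` [set M]) ->
  exists (k : nat) (v : 'I_k -> pair_fun A R) (c : 'I_k -> R),
    [/\ forall j, S (v j) & forall x y, asymptotic_pair X x y ->
      M x y = \sum_j c j * v j x y].
Proof.
move=> indS SM /existsNP[k /existsNP[v /existsNP[c]]].
move=> /not_implyP[injv /not_implyP[vS /not_implyP[rel /existsNP[j0 cj0]]]].
have [j1 vj1] : exists j, v j = M.
  apply: contrapT => /forallNP noM; apply: cj0; apply: (indS k v) => // j.
  by case: (vS j) => // /noM.
case: k v c injv vS rel j0 cj0 j1 vj1 => [|k] v c injv vS rel j0 cj0 j1 vj1.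
  by case: j1 {vj1}.
have vlift i : S (v (lift j1 i)).
  case: (vS (lift j1 i)) => //= vM; have : lift j1 i = j1 by apply: injv; rewrite vM.
  by move/eqP; rewrite eq_sym (negbTE (neq_lift j1 i)).
have rel_lift x y : asymptotic_pair X x y ->
    c j1 * M x y + \sum_i c (lift j1 i) * v (lift j1 i) x y = 0.
  by move=> /rel; rewrite (bigD1_ord j1) //= vj1.
have cj1 : c j1 != 0.
  apply/eqP => c0; apply: cj0.
  have cl i : c (lift j1 i) = 0.
    apply: (indS k (v \o lift j1) (c \o lift j1)) => // [i1 i2 /injv/lift_inj//|x y xy].
    by have := rel_lift x y xy; rewrite c0 mul0r add0r.
  by case: (unliftP j1 j0) => [i ->|->].
exists k, (v \o lift j1), (fun i => - c (lift j1 i) / c j1); split=> // x y xy.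
apply: (mulfI cj1); have /eqP := rel_lift x y xy; rewrite addr_eq0 => /eqP ->.
rewrite mulr_sumr -sumrN; apply: eq_bigr => i _ /=.
by field.
Qed.

(** The basis is a maximal independent set of cocycles that contains the given
    family.  Zorn's lemma is applied to the sets that remain independent after
    adjoining the family, because these include the empty set. *)
Lemma extend_to_basis (T0 : Type) (M : T0 -> pair_fun A R) :
  (forall i, is_shift_inv_markov_cocycle X (M i)) ->
  linearly_independent X M -> ~ countable [set: T0] ->
  exists (J : Type) (B : J -> pair_fun A R),
    is_basis_of_cocycles X B /\ ~ countable [set: J].
Proof.
move=> cocM indM uncI; pose S0 := range M.
pose P := [set T : set (pair_fun A R) | T `<=` is_shift_inv_markov_cocycle X /\
  independent (T `|` S0)].
have [F FP totF|T [[TC indT] maxT]] := @Zorn_bigcup _ P.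
  split; first by move=> N [T /FP[TC _] /TC].
  by apply: independent_bigcup => // [|T /FP[]//]; exact: independent_range.
pose S := T `|` S0.
have SC : S `<=` is_shift_inv_markov_cocycle X.
  by move=> N [/TC//|[i _ <-]]; exact: cocM.
have injM : injective M.
  move=> i i' Mii'; apply: contrapT => ii'.
  pose ij (j : 'I_2) := if j == ord0 then i else i'.
  pose c (j : 'I_2) : R := if j == ord0 then 1 else -1.
  have /eqP : c ord0 = 0.
    apply: (indM 2 ij c) => [j j'|x y _].
      rewrite /ij; case: (unliftP ord0 j) => [u ->|->];
        case: (unliftP ord0 j') => [u' ->|->] //=.
      - by rewrite (ord1 u) (ord1 u').
      - by move/esym.
    by rewrite !big_ord_recl big_ord0 /c /ij /= Mii'; ring.
  by rewrite /c eqxx oner_eq0.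
pose el N (SN : S N) : set_type S := SigSub (mem_set SN).
exists (set_type S), (fun N => val N); split; last first.
  move=> /countable_injP[f injf]; apply: uncI; apply/countable_injP.
  have SM i : S (M i) by right; exists i.
  exists (fun i => f (el _ (SM i))) => i i' _ _ /injf.
  by rewrite !inE => /(_ I I) /(congr1 val) /= /injM.
split=> [N|k i c inji rel|M' cocM'].
- by apply: SC; have := valP N; rewrite inE.
- apply: (indT k (fun j => val (i j)) c) => // [j j' /val_inj/inji//|j].
  by have := valP (i j); rewrite inE.
have [SM'|nSM'] := pselect (S M').
  exists 1%N, (fun=> el _ SM'), (fun=> 1) => x y _.
  by rewrite big_ord1 mul1r.
have [|k [v [c [vS M'E]]]] := @dependent_span S M' indT nSM'; last first.
  by exists k, (fun j => el _ (vS j)), c.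
rewrite /S setUAC => indT'; apply: (maxT (T `|` [set M'])).
  split=> [N TN|TT]; first by left.
  by apply: nSM'; left; apply: TT; right.
by split=> // N [/TC//|->].
Qed.
End Basis.

(** * The cell shift *)

Definition letter : Type := option bool.
HB.instance Definition _ := Finite.on letter.
HB.instance Definition _ := Pointed.on letter.

(** The default value 0 is the width given below to cells that are unbounded to
    the right. *)
Definition first (P : pred nat) : nat :=
  if pselect (exists k, P k) is left h then ex_minn h else 0.

Lemma firstP (P : pred nat) : (exists k, P k) ->
  P (first P) /\ forall j, (j < first P)%N -> ~~ P j.
Proof.
move=> exP; rewrite /first; case: pselect => // h; case: ex_minnP => m Pm minm.
by split=> // j jm; apply: contraL jm => /minm; rewrite -leqNgt.
Qed.

Lemma first_eq (P : pred nat) k : P k -> (forall j, (j < k)%N -> ~~ P j) ->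
  first P = k.
Proof.
move=> Pk ltk; have [PP Pmin] := firstP (ex_intro P k Pk).
apply/eqP; rewrite eqn_leq; apply/andP; split; rewrite leqNgt; apply/negP.
  by move=> /Pmin; rewrite Pk.
by move=> /ltk; rewrite PP.
Qed.

(** It is enough that [P] and [Q] agree as long as neither has occurred. *)
Lemma eq_first (P Q : pred nat) :
  (forall k, (forall j, (j < k)%N -> ~~ P j /\ ~~ Q j) -> P k = Q k) ->
  first P = first Q.
Proof.
have half (P' Q' : pred nat) : (exists k, P' k) ->
    (forall k, (forall j, (j < k)%N -> ~~ P' j /\ ~~ Q' j) -> P' k = Q' k) ->
    first P' = first Q'.
  move=> /firstP[Pk ltk] PQ; apply/esym/first_eq; last first.
    elim/ltn_ind => j IH jk; rewrite -PQ ?ltk // => i ij.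
    by have ik := ltn_trans ij jk; split; [exact: ltk|exact: IH].
  rewrite -PQ // => j jk; split; first exact: ltk.
  elim/ltn_ind: j jk => j IH jk; rewrite -PQ ?ltk // => i ij.
  by have ik := ltn_trans ij jk; split; [exact: ltk|exact: IH].
move=> PQ; have [/half|noP] := pselect (exists k, P k); first exact.
have [/half H|noQ] := pselect (exists k, Q k).
  by apply/esym/H => k kj; apply/esym/PQ => j /kj[].
by rewrite /first; do 2 case: pselect => //.
Qed.

Definition cell_shift : set (config letter) := [set x |
  (forall i j : int, (x (i, j) == None) = (x (i, j + 1) == None)) /\
  (forall (i j : int) b, x (i, j) = Some b -> x (i + 1, j) != Some (~~ b))].

Definition edge_pattern (e : site) (l l' : letter) : pattern letter :=
  restrict (fun m => if m == 0 then l else l') [fset 0; e]%fset.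

Lemma edge_patternP (e n : site) (l l' : letter) (x : config letter) : e != 0 ->
  cylinder (edge_pattern e l l') (shift n x) <-> x n = l /\ x (e + n) = l'.
Proof.
move=> e0; rewrite cylinder_restrict; split=> [H|[<- <-] m].
  have := H e; have := H 0; rewrite /shift !inE !eqxx orbT add0r (negbTE e0).
  by move=> -> // ->.
by rewrite /shift !inE => /orP[]/eqP ->; rewrite ?eqxx ?add0r // (negbTE e0).
Qed.

Lemma cell_shift_sft : is_nn_sft cell_shift.
Proof.
pose bb := [:: true; false].
pose forbid : seq (pattern letter) :=
  [seq edge_pattern (1, 0) (Some b) (Some (~~ b)) | b <- bb] ++
  ([seq edge_pattern (0, 1) None (Some b) | b <- bb] ++
   [seq edge_pattern (0, 1) (Some b) None | b <- bb]).
have right (i j : int) : ((1, 0) : site) + (i, j) = (i + 1, j).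
  by rewrite -[LHS]/(1 + i, 0 + j) add0r addrC.
have up (i j : int) : ((0, 1) : site) + (i, j) = (i, j + 1).
  by rewrite -[LHS]/(0 + i, 1 + j) add0r addrC.
have inbb b : b \in bb by case: b.
exists [fset a in forbid]%fset.
  move=> a; rewrite in_fset !mem_cat => H.
  have [e [ne [l [l' ->]]]] : exists e : site,
      norm1 (0 - e) = 1%N /\ exists l l', a = edge_pattern e l l'.
    case/orP: H => [/mapP[b _ ->]|/orP[]/mapP[b _ ->]].
    - by exists (1, 0); split=> //; do 2 eexists.
    - by exists (0, 1); split=> //; do 2 eexists.
    - by exists (0, 1); split=> //; do 2 eexists.
  by exists 0, e; split=> //; rewrite /adjacent ne.
apply/seteqP; split=> x.
  move=> [vert horiz] a n; rewrite in_fset !mem_cat; case: n => i j.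
  case/orP => [/mapP[b _ ->]|/orP[]/mapP[b _ ->]] /edge_patternP-/(_ isT).
  - by rewrite right => -[/horiz/eqP].
  - by rewrite up => -[xn xe]; have := vert i j; rewrite xn xe.
  - by rewrite up => -[xn xe]; have := vert i j; rewrite xn xe.
move=> noforbid; split=> [i j|i j b xij].
  case xn : (x (i, j)) => [b|]; case xe: (x (i, j + 1)) => [c|] //; exfalso.
    apply: (noforbid (edge_pattern (0, 1) (Some b) None) (i, j)).
      by rewrite in_fset !mem_cat (map_f _ (inbb b)) !orbT.
    by apply/edge_patternP => //; rewrite xn up.
  apply: (noforbid (edge_pattern (0, 1) None (Some c)) (i, j)).
    by rewrite in_fset !mem_cat (map_f _ (inbb c)) !orbT.
  by apply/edge_patternP => //; rewrite xn up.
apply/eqP => xe; apply: (noforbid (edge_pattern (1, 0) (Some b) (Some (~~ b))) (i, j)).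
  by rewrite in_fset !mem_cat (map_f _ (inbb b)).
by apply/edge_patternP => //; rewrite xij right.
Qed.

Lemma wall_column x (i j k : int) : cell_shift x ->
  (x (i, j) == None) = (x (i, k) == None).
Proof.
move=> [vert _].
suff up (n : nat) l : (x (i, l) == None) = (x (i, l + n%:Z) == None).
  have [jk|kj] := lerP j k.
    by rewrite (up `|k - j|%N j); congr (x (_, _) == _); lia.
  by rewrite (up `|j - k|%N k); congr (x (_, _) == _); lia.
elim: n => [|n IH]; first by rewrite addr0.
by rewrite IH vert; congr (x (_, _) == _); lia.
Qed.

(** The column of [n] contains a site where [x] and [y] agree, and this site
    tells whether the column is a wall. *)
Lemma asymptotic_wall x y n : asymptotic_pair cell_shift x y ->
  (x n == None) = (y n == None).
Proof.
case: n => i j [Yx Yy fin].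
have [k xk] : exists k : nat, x (i, k%:Z) = y (i, k%:Z).
  apply: contrapT => /forallNP alldiff; apply: infinite_nat.
  have : finite_set ((fun k : nat => (i, k%:Z) : site) @^-1` [set n | x n <> y n]).
    by apply: finite_preimage fin => u v _ _ [].
  by apply: sub_finite_set => k _; exact: alldiff.
by rewrite (wall_column _ j k%:Z Yx) xk (wall_column _ j k%:Z Yy).
Qed.

Lemma asymptotic_pair_sym (A : finPointedType) (X : set (config A)) x y :
  asymptotic_pair X x y -> asymptotic_pair X y x.
Proof.
by case=> Xx Xy fin; split=> //; apply: sub_finite_set fin => n /= xy; exact: nesym.
Qed.

(** Without a wall, each point repeats its own colour at the next site. *)
Lemma diff_next x y n (s : int) : asymptotic_pair cell_shift x y -> `|s|%N = 1%N ->
  x n <> y n -> x (n.1 + s, n.2) <> None ->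
  x (n.1 + s, n.2) <> y (n.1 + s, n.2).
Proof.
case: n => i j xy s1 /=.
have := asymptotic_wall (i, j) xy; have := asymptotic_wall (i + s, j) xy.
case: xy => [[_ hx] [_ hy] _]; have [->|->] : s = 1 \/ s = -1 by lia.
  have := hx i j; have := hy i j; case: (x (i, j)) => [b|]; case: (y (i, j)) => [c|] //.
  case: (x (i + 1, j)) => [b'|]; case: (y (i + 1, j)) => [c'|] //.
  by move=> /(_ _ erefl) + /(_ _ erefl); case: b b' c c' => [] [] [] [].
have := hx (i - 1) j; have := hy (i - 1) j; rewrite subrK.
case: (x (i, j)) => [b|]; case: (y (i, j)) => [c|] //.
case: (x (i - 1, j)) => [b'|]; case: (y (i - 1, j)) => [c'|] //.
by move=> /(_ _ erefl) + /(_ _ erefl); case: b b' c c' => [] [] [] [].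
Qed.

Lemma next_in_collar (F : {fset site}) n (s : int) : `|s|%N = 1%N -> n \in F ->
  ((n.1 + s, n.2) : site) \in (F `|` boundary F)%fset.
Proof.
move=> s1 nF; rewrite in_fsetU in_boundary; case: (_ \in F) => //=.
apply/hasP; exists n => //; case: n {nF} => i j.
by rewrite /adjacent /norm1 /=; lia.
Qed.

Definition reads_walls (q : int -> bool) (x : config letter) (j : int)
    (L : {fset site}) : Prop :=
  forall i : int, ((i, j) : site) \in L -> q i = (x (i, j) == None).

(** A difference between [x] and [y] propagates along a row, in the direction
    [s], up to the next wall.  The walls are described by a function [q] that is
    compared with [x] only on [F] and its boundary: it will be read from a
    second pair of points, or from random walls. *)
Lemma diff_run x y (F : {fset site}) n (s : int) (q : int -> bool) :
  asymptotic_pair cell_shift x y -> (forall m, x m <> y m -> m \in F) ->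
  reads_walls q x n.2 (F `|` boundary F)%fset -> `|s|%N = 1%N -> x n <> y n ->
  forall k : nat, (forall i : nat, (0 < i <= k)%N -> ~~ q (n.1 + s * i%:Z)) ->
  x (n.1 + s * k%:Z, n.2) <> y (n.1 + s * k%:Z, n.2).
Proof.
move=> xy diffF qx s1 xyn; elim=> [|k IH] qk.
  by rewrite mulr0 addr0; case: n xyn {qx qk}.
have {}IH : x (n.1 + s * k%:Z, n.2) <> y (n.1 + s * k%:Z, n.2).
  by apply: IH => i /andP[i0 ik]; apply: qk; rewrite i0 ltnW.
have E : n.1 + s * k.+1%:Z = n.1 + s * k%:Z + s by lia.
rewrite E; apply: (diff_next (n := (n.1 + s * k%:Z, n.2)) xy s1 IH) => /=.
apply/eqP; rewrite -qx; first by rewrite -E; apply: qk; rewrite ltn0Sn leqnn.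
exact: (next_in_collar (n := (n.1 + s * k%:Z, n.2)) s1 (diffF _ IH)).
Qed.

Definition width (q : int -> bool) (i : int) : nat := first (fun k => q (i + k%:Z)).

Definition walls (x : config letter) (j : int) : int -> bool :=
  fun i => x (i, j) == None.

(** While no wall is met the sites differ, hence lie in [F], and the wall that
    ends the cell lies in [F] or its boundary. *)
Lemma width_local x y (F : {fset site}) n (q : int -> bool) :
  asymptotic_pair cell_shift x y -> (forall m, x m <> y m -> m \in F) ->
  reads_walls q x n.2 (F `|` boundary F)%fset -> x n <> y n ->
  width q n.1 = width (walls x n.2) n.1.
Proof.
move=> xy diffF qx xyn; apply: eq_first => k qk.
apply: (qx); case: k qk => [|k] qk.
  by rewrite addr0 in_fsetU diffF //; case: n xyn {qk qx}.
have -> : n.1 + k.+1%:Z = n.1 + k%:Z + 1 by lia.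
apply: (next_in_collar (n := (n.1 + k%:Z, n.2))) => //; apply: (diffF).
have := diff_run (s := 1) xy diffF qx erefl xyn (k := k); rewrite mul1r.
by apply=> i /andP[_ ik]; rewrite mul1r; have [] := qk i ik.
Qed.

(** * Cell cocycles *)

Section CellCocycle.
Context {R : realType}.
Implicit Types (x y : config letter) (lam : nat -> R).

Definition bit_value (l : letter) : R := (l == Some true)%:R.

(** A cell is accounted for at its leftmost site. *)
Definition cell_term lam x y (n : site) : R :=
  if x (n.1 - 1, n.2) == None
  then lam (width (walls x n.2) n.1) * (bit_value (y n) - bit_value (x n))
  else 0.

Definition cell_cocycle lam : pair_fun letter R :=
  fun x y => \sum_(n <- diff_sites x y) cell_term lam x y n.

Lemma cell_term0 lam x y n : x n = y n -> cell_term lam x y n = 0.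
Proof. by rewrite /cell_term => ->; rewrite subrr mulr0; case: ifP. Qed.

Lemma cell_cocycleE lam x y (G : {fset site}) : asymptotic_pair cell_shift x y ->
  (forall n, x n <> y n -> n \in G) ->
  cell_cocycle lam x y = \sum_(n <- G) cell_term lam x y n.
Proof.
move=> xy diffG; apply: big_fset_incl.
  by apply/fsubsetP => n; rewrite (fset_diff_sites _ xy) => /eqP /diffG.
by move=> n _; rewrite (fset_diff_sites _ xy) negbK => /eqP /cell_term0.
Qed.

Lemma asymptotic_walls x y : asymptotic_pair cell_shift x y -> walls x = walls y.
Proof.
by move=> xy; apply/funext => j; apply/funext => i; exact: asymptotic_wall xy.
Qed.

Lemma cell_cocycle_cocycle lam : is_cocycle cell_shift (cell_cocycle lam).
Proof.
move=> x y z xy yz.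
have xz : asymptotic_pair cell_shift x z.
  case: xy yz => Yx Yy fxy [_ Yz fyz]; split=> //.
  have : finite_set ([set n | x n <> y n] `|` [set n | y n <> z n]).
    by rewrite finite_setU.
  apply: sub_finite_set => n /= xz; have [xyn|] := eqVneq (x n) (y n); last first.
    by move/eqP; left.
  by right; rewrite -xyn.
pose G := (diff_sites x y `|` diff_sites y z `|` diff_sites x z)%fset.
rewrite !(@cell_cocycleE _ _ _ G) //; first last.
- by move=> n /(mem_diff_sites xz) nd; rewrite !in_fsetU nd !orbT.
- by move=> n /(mem_diff_sites xy) nd; rewrite !in_fsetU nd.
- by move=> n /(mem_diff_sites yz) nd; rewrite !in_fsetU nd !orbT.
rewrite -big_split; apply: eq_bigr => n _ /=.
rewrite /cell_term (asymptotic_walls xy) (asymptotic_wall _ xy).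
by case: ifP => _; [ring|rewrite addr0].
Qed.

(** Both cocycles are sums over [F]; at a site where [x] and [y] differ, the
    neighbour on the left is in [F] or its boundary and the width is given by
    [width_local]. *)
Lemma cell_cocycle_markov lam : is_markov_cocycle cell_shift (cell_cocycle lam).
Proof.
split=> [|F x y x' y' xy xy' Fxy Fxy' /eq_restrict xx' /eq_restrict yy'].
  exact: cell_cocycle_cocycle.
have offF u v : (forall n, n \notin F -> u n = v n :> letter) ->
    forall n, u n <> v n -> n \in F.
  by move=> uv n; apply: contra_notT => /uv.
have collar n : n \in F -> n \in (F `|` boundary F)%fset by rewrite in_fsetU => ->.
rewrite (cell_cocycleE _ xy (offF _ _ Fxy)) (cell_cocycleE _ xy' (offF _ _ Fxy')).
rewrite !big_seq; apply: eq_bigr => n nF.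
have [xyn|/eqP xyn] := eqVneq (x n) (y n).
  by rewrite !cell_term0 // -xx' -?yy' ?collar.
rewrite /cell_term xx' ?(next_in_collar (s := -1)) // xx' ?yy' ?collar //.
rewrite -(width_local (q := walls x' n.2) xy (offF _ _ Fxy)) //.
by move=> i /xx' E; rewrite /walls E.
Qed.

Lemma cell_cocycle_shift lam :
  is_shift_inv_markov_cocycle cell_shift (cell_cocycle lam).
Proof.
split=> [|v x y xy]; first exact: cell_cocycle_markov.
have sxy : asymptotic_pair cell_shift (shift v x) (shift v y).
  case: xy => Yx Yy fin; split; [| |].
  - exact: sft_shift cell_shift_sft _.
  - exact: sft_shift cell_shift_sft _.
  - apply: (@finite_preimage _ _ _ (fun n : site => n + v)) fin.
    by move=> m n _ _ /addIr.
rewrite (@cell_cocycleE _ _ _ [fset n - v | n in diff_sites x y]%fset) //;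
  last first.
  move=> n nd; apply/imfsetP; exists (n + v); last by rewrite addrK.
  exact: (mem_diff_sites xy).
rewrite big_imfset /=; last by move=> m n _ _ /addIr.
rewrite /cell_cocycle; apply: eq_bigr => n _; rewrite /cell_term /shift subrK.
case: n v {sxy} => i j [a b].
have -> : (i - a - 1, j - b) + (a, b) = (i - 1, j) :> site.
  by rewrite -[LHS]/(i - a - 1 + a, j - b + b) addrAC !subrK.
case: ifP => // _; congr (lam (first _) * _).
apply/funext => k; rewrite /walls /=.
have -> // : (i - a + k%:Z, j - b) + (a, b) = (i + k%:Z, j) :> site.
by rewrite -[LHS]/(i - a + k%:Z + a, j - b + b) addrAC !subrK.
Qed.

(** A vertical band of [w] columns without walls, whose cell in row 0 has
    colour [l]. *)
Definition strip (w : nat) (l : letter) : config letter :=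
  fun n => if (0 <= n.1 < w%:Z) then (if n.2 == 0 then l else Some false) else None.

Lemma strip_cell_shift w b : cell_shift (strip w (Some b)).
Proof.
split=> [i j|i j c]; rewrite /strip /=.
  by case: ifP => // _; case: ifP; case: ifP.
by case: ifP => // _; case: ifP => // _ [<-]; case: ifP => // _; case: (b).
Qed.

Lemma strip_diff w n : strip w (Some false) n <> strip w (Some true) n <->
  (0 <= n.1 < w%:Z) && (n.2 == 0).
Proof. by rewrite /strip; case: (0 <= n.1 < w%:Z); case: (n.2 == 0). Qed.

Definition strip_cell (w : nat) : {fset site} :=
  [fset (i%:Z, 0) | i in iota 0 w]%fset.

Lemma mem_strip_cell w n : (n \in strip_cell w) = (0 <= n.1 < w%:Z) && (n.2 == 0).
Proof.
apply/imfsetP/idP => /= [[i]|]; first by rewrite mem_iota => iw -> /=; lia.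
case: n => i j /= /andP[iw /eqP ->]; exists `|i|%N; first by rewrite mem_iota; lia.
by congr (_, _); lia.
Qed.

Lemma strip_asymptotic w :
  asymptotic_pair cell_shift (strip w (Some false)) (strip w (Some true)).
Proof.
split; [exact: strip_cell_shift|exact: strip_cell_shift|].
apply: (sub_finite_set _ (finite_fset (strip_cell w))) => n /strip_diff.
by rewrite /= mem_strip_cell.
Qed.

Lemma cell_cocycle_strip lam w : (0 < w)%N ->
  cell_cocycle lam (strip w (Some false)) (strip w (Some true)) = lam w.
Proof.
move=> w0.
rewrite (@cell_cocycleE _ _ _ (strip_cell w) (strip_asymptotic w)); last first.
  by move=> n /strip_diff; rewrite mem_strip_cell.
rewrite (big_fsetD1 (0, 0)); last by rewrite mem_strip_cell /= ltz_nat w0.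
rewrite /= big1_seq => [|[i j]].
  rewrite addr0 /cell_term /strip /= ltz_nat w0 /bit_value /= subr0 mulr1; congr lam.
  apply: first_eq => [|k kw]; rewrite /walls /=; first by case: ifP => //; lia.
  by rewrite ifT //; lia.
rewrite !inE mem_strip_cell xpair_eqE /= => /andP[].
move=> ij /andP[i0w /eqP j0]; rewrite /cell_term /strip /= j0 /=.
by rewrite ifF //; move: ij; rewrite j0 eqxx andbT; case: ifP => //; lia.
Qed.

End CellCocycle.

(** In a cell of width two, a difference at one site forces a difference at the
    other one. *)
Lemma cell_shift_no_pivot : ~ pivot_property cell_shift.
Proof.
pose x := strip 2 (Some false); pose y := strip 2 (Some true).
have xy : x <> y by move=> E; have : x (0, 0) = y (0, 0) by rewrite E.
move=> /(_ x y (strip_asymptotic 2) xy)[N [z [z0 zN Yz piv]]].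
have N0 : (0 < N)%N.
  by rewrite lt0n; apply/eqP => N0; apply: xy; rewrite -z0 -zN N0.
have [n [xz uniq_n]] := piv 0%N N0; rewrite z0 in xz uniq_n.
have xz1 : asymptotic_pair cell_shift x (z 1%N).
  split; [exact: strip_cell_shift|exact: Yz|].
  by apply: (sub_finite_set _ (finite_set1 n)) => m /uniq_n ->.
have xn : x n <> None.
  move=> xn; have := asymptotic_wall n xz1; rewrite xn eqxx => /esym/eqP z1n.
  by rewrite xn z1n in xz.
pose s : int := if n.1 == 0 then 1 else -1.
have s1 : `|s|%N = 1%N by rewrite /s; case: ifP.
have xs : x (n.1 + s, n.2) <> None.
  move: xn; rewrite /x /strip /s /=; case: (boolP (0 <= n.1 < 2)) => // n01 _.
  case: eqP => n1; [by rewrite n1; case: ifP|rewrite ifT].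
    by case: ifP.
  by move: (n.1) n01 n1 => i; lia.
have /uniq_n/(congr1 (fun m : site => m.1)) := diff_next xz1 s1 xz xs.
by rewrite /= -[LHS]addr0 => /addrI s0; rewrite -s0 in s1.
Qed.

(** * Painting the cells *)

(** The leftmost site of the cell that contains [i], in a row with walls [q]. *)
Definition start (q : int -> bool) (i : int) : int :=
  i - (first (fun k => q (i - 1 - k%:Z)))%:Z.

Definition left_recurrent (q : int -> bool) : Prop :=
  forall i : int, exists k : nat, q (i - k%:Z).

Lemma startP (q : int -> bool) (i : int) : left_recurrent q ->
  [/\ start q i <= i, q (start q i - 1) &
      forall t : int, start q i <= t < i -> ~~ q t].
Proof.
move=> /(_ (i - 1)) /firstP; rewrite /start; set m := first _ => -[qm nq]; split.
- by lia.
- by have -> : i - m%:Z - 1 = i - 1 - m%:Z by lia.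
- move=> t ti; have := nq (absz (i - 1 - t)%R).
  have -> : i - 1 - (absz (i - 1 - t)%R)%:Z = t by lia.
  by apply; lia.
Qed.

Lemma start_eq (q : int -> bool) (i l : int) : l <= i -> q (l - 1) ->
  (forall t : int, l <= t < i -> ~~ q t) -> start q i = l.
Proof.
move=> li ql nq; rewrite /start (@first_eq _ `|i - l|%N); first by lia.
  by have -> : i - 1 - `|i - l|%N%:Z = l - 1 by lia.
by move=> j ji; apply: nq; lia.
Qed.

(** The colour of a cell is read from [s] at its leftmost site. *)
Definition paint (q : int -> bool) (s : site -> bool) : config letter :=
  fun n => if q n.1 then None else Some (s (start q n.1, n.2)).

Lemma paint_wall q s n : (paint q s n == None) = q n.1.
Proof. by rewrite /paint; case: ifP. Qed.

Lemma paint_cell_shift q s : left_recurrent q -> cell_shift (paint q s).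
Proof.
move=> rec; split=> [i j|i j b]; first by rewrite !paint_wall.
rewrite /paint /=; case: ifPn => // qi [<-]; case: ifPn => // qi1.
have [li ql nq] := startP i rec.
rewrite (@start_eq q (i + 1) (start q i)); first by case: (s _).
- by lia.
- by [].
- by move=> t ti; have [->//|ti'] := eqVneq t i; apply: nq; lia.
Qed.

Section Repaint.
Variables (q : int -> bool) (x y : config letter) (L : {fset site}).
Hypotheses (rec : left_recurrent q) (xy : asymptotic_pair cell_shift x y).
Hypothesis FL : (diff_sites x y `|` boundary (diff_sites x y) `<=` L)%fset.
Variable s : site -> bool.
Hypothesis sx : forall n, n \in L -> paint q s n = x n.

(** The sites at which the coins [s] are read by [paint q s] on the window
    [L]. *)
Definition cell_starts : {fset site} :=
  [fset (start q n.1, n.2) | n in L & ~~ q n.1]%fset.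

Let diffF m : x m <> y m -> m \in diff_sites x y := @mem_diff_sites _ _ _ _ m xy.

Let diffL m : m \in diff_sites x y -> m \in L.
Proof. by move=> mF; apply: (fsubsetP FL); rewrite in_fsetU mF. Qed.

Let reads j :
  reads_walls q x j (diff_sites x y `|` boundary (diff_sites x y))%fset.
Proof. by move=> i /(fsubsetP FL) /sx <-; rewrite paint_wall. Qed.

Lemma open_diff n : n \in diff_sites x y -> ~~ q n.1.
Proof.
move=> nF; rewrite -(paint_wall q s) sx ?diffL //.
move: nF; rewrite (fset_diff_sites _ xy); have := asymptotic_wall n xy.
by case: (x n) => // + xyn; rewrite eqxx => /esym; case: (y n) xyn.
Qed.

(** Inside [L], the cells on which [x] and [y] differ are bounded by walls of
    [x], which are those of [q]. *)
Lemma start_diff n : ~~ q n.1 ->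
  (n \in diff_sites x y) = (((start q n.1, n.2) : site) \in diff_sites x y).
Proof.
case: n => i j /= qi; have [li ql nq] := startP i rec.
apply/idP/idP => [nF|dF]; apply: (diffF).
  have := @diff_run x y _ (i, j) (-1) q xy diffF (@reads _) erefl _
    (absz (i - start q i)).
  rewrite !mulN1r /=; have -> : i - (absz (i - start q i))%:Z = start q i by lia.
  apply; first by apply/eqP; rewrite -(fset_diff_sites _ xy).
  by move=> k k0; rewrite mulN1r; apply: nq; lia.
have := @diff_run x y _ (start q i, j) 1 q xy diffF (@reads _) erefl _
  (absz (i - start q i)).
rewrite /= !mul1r; have -> : start q i + (absz (i - start q i))%:Z = i by lia.
apply; first by apply/eqP; rewrite -(fset_diff_sites _ xy).
move=> k k0; rewrite mul1r; have [->//|ki] := eqVneq (start q i + k%:Z) i.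
by apply: nq; lia.
Qed.

(** Flip the coins of the cells where [x] and [y] differ. *)
Definition repaint (d : site) : bool := s d (+) (d \in diff_sites x y).

Lemma repaintP n : n \in L -> paint q repaint n = y n.
Proof.
move=> nL; have := sx nL; rewrite /paint; case: ifPn => qn.
  move=> xn; have := asymptotic_wall n xy; rewrite -xn eqxx.
  by move/esym/eqP.
rewrite /repaint -start_diff //; move=> xn.
have := asymptotic_wall n xy; rewrite -xn.
rewrite (fset_diff_sites _ xy) -xn; case: (y n) => // c _.
by case: (s _) c => [] [].
Qed.

Lemma cell_start_diff d : d \in diff_sites x y ->
  (d \in cell_starts) = (x (d.1 - 1, d.2) == None).
Proof.
move=> dF; have qd := open_diff dF; rewrite -reads; last first.
  exact: (next_in_collar (s := -1)).
apply/imfsetP/idP => /= [[n /= _ ->] /=|qd1].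
  by have [] := startP n.1 rec.
exists d; first by rewrite inE /= diffL.
rewrite (@start_eq q d.1 d.1) //; first by case: (d).
by move=> t; lia.
Qed.

End Repaint.

(** * The law of a painted configuration *)

Section Law.
Context {R : realType}.
Variable lam : nat -> R.

Definition logistic (t : R) : R := expR t / (1 + expR t).

Lemma logistic01 t : 0 < logistic t < 1.
Proof.
have e0 := expR_gt0 t; rewrite /logistic divr_gt0 ?addr_gt0 //=.
by rewrite ltr_pdivrMr ?addr_gt0 // mul1r ltrDr.
Qed.

Lemma coin_weight_gt0 (p : R) b : 0 < p < 1 -> 0 < coin_weight p b.
Proof. by rewrite /coin_weight; case: b; lra. Qed.

(** A coin of parameter [logistic t] has odds [expR t]. *)
Lemma coin_weight_logistic t (b c : bool) :
  coin_weight (logistic t) c =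
  expR (t * (c%:R - b%:R)) * coin_weight (logistic t) b.
Proof.
have e0 := expR_gt0 t; have e1 : 1 + expR t != 0 by rewrite gt_eqF ?addr_gt0.
have wE d : coin_weight (logistic t) d = expR (t * d%:R) / (1 + expR t).
  rewrite /coin_weight /logistic; case: d; first by rewrite mulr1.
  by rewrite mulr0 expR0; field.
by rewrite !wE mulrA -expRD; congr (expR _ / _); ring.
Qed.

Definition bias (q : int -> bool) (d : site) : R := logistic (lam (width q d.1)).

Definition independent_coins (p : site -> R) (c : R -> site -> bool) : Prop :=
  forall (D : {fset site}) v,
  unit_interval [set u | forall d, d \in D -> c u d = v d] =
  (\prod_(d <- D) coin_weight (p d) (v d))%:E.

(** On the window [L], a painted configuration determines the coins read there
    and is determined by them. *)
Lemma paint_cylinder (q : int -> bool) (s s' : site -> bool) x (L : {fset site}) :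
  (forall n, n \in L -> paint q s n = x n) ->
  cylinder (restrict x L) (paint q s') <->
  forall d, d \in cell_starts q L -> s' d = s d.
Proof.
move=> sx; rewrite cylinder_restrict; split=> [s'x _ /imfsetP[n /= +] ->|ss' n nL].
  rewrite inE => /andP[nL /negbTE qn].
  by have := etrans (s'x _ nL) (esym (sx _ nL)); rewrite /paint qn => -[].
rewrite -sx // /paint; case: ifPn => // qn; rewrite ss' //.
by apply/imfsetP; exists n => //=; rewrite inE nL.
Qed.

Lemma independent_coins_cylinder (q : int -> bool) p c s x (L : {fset site}) :
  independent_coins p c -> (forall n, n \in L -> paint q s n = x n) ->
  unit_interval [set u | cylinder (restrict x L) (paint q (c u))] =
  (\prod_(d <- cell_starts q L) coin_weight (p d) (s d))%:E.
Proof.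
move=> indep sx; rewrite -indep; congr (unit_interval _).
by apply/seteqP; split=> u /= /(paint_cylinder _ sx).
Qed.

Lemma cylinder_unpainted (q : int -> bool) (c : R -> site -> bool)
    (a : pattern letter) :
  ~ (exists s, cylinder a (paint q s)) ->
  unit_interval [set u | cylinder a (paint q (c u))] = 0%E.
Proof.
move=> nos; rewrite (_ : [set _ | _] = set0) ?measure0 //.
by apply/seteqP; split=> // u au; apply: nos; exists (c u).
Qed.

(** The probability that a painted configuration lies in a cylinder depends only
    on the joint law of the coins. *)
Lemma eq_law_independent_coins (q : int -> bool) p c c' (a : pattern letter) :
  independent_coins p c -> independent_coins p c' ->
  unit_interval [set u | cylinder a (paint q (c u))] =
  unit_interval [set u | cylinder a (paint q (c' u))].
Proof.
move=> ic ic'; have [[s as_]|nos] := pselect (exists s, cylinder a (paint q s)).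
  rewrite -[a]as_.
  rewrite (independent_coins_cylinder (s := s) ic) //.
  by rewrite (independent_coins_cylinder (s := s) ic').
by rewrite !cylinder_unpainted.
Qed.

Definition sample (q : int -> bool) : measurableTypeR R -> borel_config letter :=
  fun u => paint q (coin (bias q) u).

Lemma measurable_sample q :
  measurable_fun setT (sample q).
Proof.
apply: measurable_fun_config => n l; rewrite /sample /paint.
case: (q n.1).
  have [nl|nl] := pselect (None = l).
    by rewrite (_ : mkset _ = setT) //; apply/seteqP; split.
  by rewrite (_ : mkset _ = set0) //; apply/seteqP; split.
case: l => [b|]; last by rewrite (_ : mkset _ = set0) //; apply/seteqP; split.
have := measurable_coin (bias q) (start q n.1, n.2) b; congr measurable.
by apply/seteqP; split=> u /= => [->|[]].
Qed.

HB.instance Definition _ (q : int -> bool) :=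
  isMeasurableFun.Build _ _ _ _ (sample q) (measurable_sample q).

Definition law (q : int -> bool) : probability (borel_config letter) R :=
  distribution unit_interval (sample q).

Lemma bias01 q d : 0 < bias q d < 1.
Proof. exact: logistic01. Qed.

Lemma independent_coins_bias q : independent_coins (bias q) (coin (bias q)).
Proof. by move=> D v; apply: unit_interval_coins; exact: bias01. Qed.

Lemma law_cylinder q s x (L : {fset site}) :
  (forall n, n \in L -> paint q s n = x n) ->
  law q (cylinder (restrict x L)) =
  (\prod_(d <- cell_starts q L) coin_weight (bias q d) (s d))%:E.
Proof. exact/independent_coins_cylinder/independent_coins_bias. Qed.

Lemma law_unpainted q a : ~ (exists s, cylinder a (paint q s)) ->
  law q (cylinder a) = 0%E.
Proof. exact: cylinder_unpainted. Qed.

Lemma law_cell_shift q (E : set (borel_config letter)) : left_recurrent q ->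
  (forall x, E x -> ~ cell_shift x) -> law q E = 0%E.
Proof.
move=> rec EY; rewrite /law /distribution /pushforward /=.
rewrite (_ : _ @^-1` _ = set0) ?measure0 //.
by apply/seteqP; split=> // u /EY; apply; exact: paint_cell_shift.
Qed.

(** A shifted painting is the painting of shifted walls by shifted coins, and
    the bias of a coin depends only on the position of the walls relative to
    it. *)
Lemma law_shift q v (a : pattern letter) : left_recurrent q ->
  law q (shift v @^-1` cylinder a) = law (fun i => q (i + v.1)) (cylinder a).
Proof.
move=> rec; set q' := fun i => q (i + v.1).
have rec' : left_recurrent q'.
  by move=> i; have [k qk] := rec (i + v.1); exists k; rewrite /q' addrAC.
have startE i : start q (i + v.1) = start q' i + v.1.
  have [li ql nq] := startP i rec'; apply: start_eq.
  - by rewrite lerD2r.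
  - by rewrite addrAC.
  - move=> t ti; have := nq (t - v.1); rewrite /q' subrK; apply.
    by rewrite lerBrDr ltrBlDr.
have shift_paint s : shift v (paint q s) = paint q' (fun d => s (d + v)).
  apply/funext => -[i j]; rewrite /shift /paint.
  have -> : (i, j) + v = (i + v.1, j + v.2) :> site by case: (v).
  by rewrite /= -/(q' i) startE.
rewrite /law /distribution /pushforward /= -!comp_preimage.
transitivity (unit_interval
  [set u | cylinder a (paint q' (fun d => coin (bias q) u (d + v)))]).
  by congr (unit_interval _); apply/seteqP; split=> u /=; rewrite -shift_paint.
apply: (@eq_law_independent_coins _ (bias q')); last exact: independent_coins_bias.
move=> D w.
have -> : [set u | forall d, d \in D -> coin (bias q) u (d + v) = w d] =
    [set u | forall d, d \in [fset (d + v)%R | d in D]%fset ->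
       coin (bias q) u d = w (d - v)].
  apply/seteqP; split=> u /= H d.
    by move=> /imfsetP[e /= eD ->]; rewrite addrK H.
  by move=> dD; rewrite H ?addrK //; apply/imfsetP; exists d.
rewrite independent_coins_bias big_imfset /=; last by move=> m n _ _ /addIr.
congr EFin; apply: eq_bigr => d _; rewrite addrK.
congr (coin_weight (logistic (lam (first _))) _); apply/funext => k.
rewrite /q'; congr q; case: d v {q' rec' startE shift_paint} => ? ? [? ?] /=.
by rewrite addrAC.
Qed.

(** If coins [s] paint [x] on [L], then [repaint x y s] paints [y] there, and
    flipping the coin of a cell of width w changes its weight by the exponential
    of plus or minus [lam w].  If no coins paint [x] on [L], then none
    paint [y], and both probabilities vanish. *)
Lemma law_ratio q x y (L : {fset site}) : left_recurrent q ->
  asymptotic_pair cell_shift x y ->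
  (diff_sites x y `|` boundary (diff_sites x y) `<=` L)%fset ->
  law q (cylinder (restrict y L)) =
  ((expR (cell_cocycle lam x y))%:E * law q (cylinder (restrict x L)))%E.
Proof.
move=> rec xy FL.
have sym : diff_sites y x = diff_sites x y.
  apply/fsetP => n; rewrite (fset_diff_sites _ xy).
  by rewrite (fset_diff_sites _ (asymptotic_pair_sym xy)) eq_sym.
have [[s sx]|nox] := pselect (exists s, cylinder (restrict x L) (paint q s));
  last first.
  rewrite !law_unpainted ?mule0 // => -[s /cylinder_restrict sy]; apply: nox.
  exists (repaint y x s); apply/cylinder_restrict.
  by apply: repaintP => //; [exact: asymptotic_pair_sym|rewrite sym].
move/cylinder_restrict in sx.
rewrite (law_cylinder (repaintP rec xy FL sx)) (law_cylinder sx) -EFinM; congr EFin.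
pose t d := cell_term lam x y d.
have weight d : d \in cell_starts q L ->
    coin_weight (bias q d) (repaint x y s d) =
    expR (if d \in diff_sites x y then t d else 0) * coin_weight (bias q d) (s d).
  move=> dS; rewrite /repaint; case: ifPn => dF; last by rewrite addbF expR0 mul1r.
  rewrite addbT (coin_weight_logistic _ (s d)); congr (expR _ * _).
  have := dS; rewrite (cell_start_diff rec xy FL sx dF) /t /cell_term => wd.
  have xyd : x d <> y d by apply/eqP; rewrite -(fset_diff_sites _ xy).
  rewrite wd (width_local xy (fun m => mem_diff_sites xy (n := m)) _ xyd); last first.
    by move=> i /(fsubsetP FL) /sx <-; rewrite paint_wall.
  have start_d : start q d.1 = d.1.
    case/imfsetP: dS => n /= _ ->; have [_ ql _] := startP n.1 rec.
    by apply: start_eq => //= k; lia.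
  have dL : d \in L by apply: (fsubsetP FL); rewrite in_fsetU dF.
  have := sx d dL; have := repaintP rec xy FL sx dL.
  rewrite /paint (negbTE (open_diff xy FL sx dF)) start_d -surjective_pairing.
  rewrite /repaint dF addbT => <- <-; rewrite /bit_value.
  by congr (_ * _); case: (s d); rewrite /= ?subr0 ?sub0r.
rewrite (eq_big_seq _ weight) big_split /= -expR_sum; congr (expR _ * _).
rewrite -big_mkcond /= /cell_cocycle [RHS](bigID (fun d => d \in cell_starts q L)) /=.
rewrite [X in _ = _ + X]big_seq_cond [X in _ = _ + X]big1 ?addr0; last first.
  move=> d /andP[dF]; rewrite (cell_start_diff rec xy FL sx dF) /cell_term => nd.
  by rewrite (negbTE nd).
rewrite -[LHS]big_filter -[RHS]big_filter; apply: perm_big; apply: uniq_perm.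
- by rewrite filter_uniq // fset_uniq.
- by rewrite filter_uniq // fset_uniq.
- by move=> d; rewrite !mem_filter andbC.
Qed.

End Law.

(** * Random walls *)

(** If [r] contains no wall, all columns become walls: in this way every
    periodic sequence has walls arbitrarily far to the left. *)
Definition periodic_walls (k : nat) (r : {ffun 'I_k.+2 -> bool}) : int -> bool :=
  fun i => r i%:~R || [forall c, ~~ r c].

Lemma periodic_walls_left_recurrent k (r : {ffun 'I_k.+2 -> bool}) :
  left_recurrent (periodic_walls r).
Proof.
move=> i; have [nor|] := boolP [forall c, ~~ r c].
  by exists 0%N; rewrite /periodic_walls nor orbT.
rewrite negb_forall => /existsP[c /negPn rc]; exists (i%:~R - c : 'I_k.+2).
by rewrite /periodic_walls intrB -pmulrn natr_Zp opprB addrC subrK rc.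
Qed.

Lemma periodic_walls_shift k (r : {ffun 'I_k.+2 -> bool}) (t : int) :
  (fun i => periodic_walls r (i + t)) =
  periodic_walls [ffun c => r (c + t%:~R)].
Proof.
apply/funext => i; rewrite /periodic_walls intrD ffunE; congr (_ || _).
apply/forallP/forallP => H c; first by rewrite ffunE.
by have := H (c - t%:~R); rewrite ffunE subrK.
Qed.

Section Mixture.
Context {R : realType}.
Variable lam : nat -> R.

Let N k : nat := #|{ffun 'I_k.+2 -> bool}|.

(** The period k + 2 has probability 2 ^ -(k + 1), shared equally by the [N k]
    sequences of that period. *)
Lemma mixture_weight_ge0 k : 0 <= 1 / (2 ^ (k + 1))%:R / (N k)%:R :> R.
Proof. by rewrite !divr_ge0. Qed.

Definition mixture_weight k : {nonneg R} := NngNum (mixture_weight_ge0 k).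

Definition mixture_term k : {measure set (borel_config letter) -> \bar R} :=
  mscale (mixture_weight k) (msum (fun n => law lam (periodic_walls
    (nth [ffun=> false] (enum {ffun 'I_k.+2 -> bool}) n))) (N k)).

Definition cell_measure : set (borel_config letter) -> \bar R :=
  mseries mixture_term 0.

HB.instance Definition _ := Measure.on cell_measure.

Lemma cell_measureE E : cell_measure E =
  (\sum_(0 <= k <oo) ((mixture_weight k)%:num%:E *
     \sum_(r : {ffun 'I_k.+2 -> bool}) law lam (periodic_walls r) E))%E.
Proof.
apply: eq_eseriesr => k _; rewrite /mixture_term /= /mscale /msum; congr (_ * _)%E.
rewrite -big_enum (big_nth [ffun=> false]) big_mkord -cardE.
by apply: eq_bigr.
Qed.

Lemma cell_measureT : cell_measure setT = 1%E.
Proof.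
rewrite cell_measureE.
transitivity (\sum_(0 <= k <oo) ((1 : R) / (2 ^ (k + 1))%:R)%:E)%E.
  apply: eq_eseriesr => k _.
  rewrite (eq_bigr (fun=> 1%E)) => [|r _]; last exact: probability_setT.
  rewrite sumEFin sumr_const -EFinM; congr EFin; rewrite /= -/(N k) divfK //.
  by rewrite pnatr_eq0 -lt0n; apply/card_gt0P; exists [ffun=> false].
have /cvg_lim -> // := @cvg_geometric_eseries_half R 1 0.
by rewrite expr0 divr1.
Qed.

HB.instance Definition _ :=
  Measure_isProbability.Build _ _ _ cell_measure cell_measureT.

(** A shift permutes the wall sequences of a given period. *)
Lemma cell_measure_shift_cylinder v a :
  cell_measure (shift v @^-1` cylinder a) = cell_measure (cylinder a).
Proof.
rewrite !cell_measureE; apply: eq_eseriesr => k _; congr (_ * _)%E.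
rewrite [RHS](reindex (fun r : {ffun 'I_k.+2 -> bool} =>
  [ffun c => r (c + v.1%:~R)])) /=.
  apply: eq_bigr => r _; rewrite -periodic_walls_shift; apply: law_shift.
  exact: periodic_walls_left_recurrent.
exists (fun r : {ffun 'I_k.+2 -> bool} => [ffun c => r (c - v.1%:~R)]) => r _;
  by apply/ffunP => c; rewrite !ffunE ?subrK ?addrK.
Qed.

HB.instance Definition _ v :=
  isMeasurableFun.Build _ _ _ _
    (shift v : borel_config letter -> borel_config letter) (measurable_shift v).

Lemma cell_measure_shift : is_shift_inv_measure cell_measure.
Proof.
move=> v E mE.
have -> : @shift letter v @` E = shift (- v) @^-1` E.
  apply/seteqP; split=> x /=.
    move=> [y Ey <-]; rewrite (_ : shift _ _ = y) //.
    by apply/funext => n; rewrite /shift subrK.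
  move=> Ex; exists (shift (- v) x) => //.
  by apply/funext => n; rewrite /shift addrK.
apply/esym; apply: (@eq_measure_cylinder _ _ cell_measure
  (distribution cell_measure (shift (- v)))) => //.
  by have := ltry (1 : R); rewrite -cell_measureT.
by move=> a; apply/esym; exact: cell_measure_shift_cylinder.
Qed.

Lemma cell_measure_null (E : set (borel_config letter)) :
  (forall x, E x -> ~ cell_shift x) -> cell_measure E = 0%E.
Proof.
move=> EY; rewrite cell_measureE eseries0 // => k _ _.
rewrite big1 ?mule0 // => r _; apply: law_cell_shift => //.
exact: periodic_walls_left_recurrent.
Qed.

Lemma cell_measure_ge_law k (r : {ffun 'I_k.+2 -> bool}) E :
  (0 < law lam (periodic_walls r) E)%E -> (0 < cell_measure E)%E.
Proof.
move=> lE; rewrite cell_measureE.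
have term_ge0 j : (0 <= (mixture_weight j)%:num%:E *
     \sum_(r' : {ffun 'I_j.+2 -> bool}) law lam (periodic_walls r') E)%E.
  by apply: mule_ge0 => //; apply: sume_ge0.
apply: lt_le_trans (nneseries_lim_ge k.+1 (fun j _ _ => term_ge0 j)).
rewrite big_nat_recr //=; apply: lte_paddl.
  by apply: sume_ge0 => i _; exact: term_ge0.
apply: mule_gt0.
  rewrite lte_fin !divr_gt0 ?ltr0n ?expn_gt0 //.
  by apply/card_gt0P; exists [ffun=> false].
rewrite (bigD1 r) //=; apply: lte_paddr; [by apply: sume_ge0|exact: lE].
Qed.

(** By [law_ratio] the factor is the same for all walls. *)
Lemma cell_measure_ratio x y (L : {fset site}) : asymptotic_pair cell_shift x y ->
  (diff_sites x y `|` boundary (diff_sites x y) `<=` L)%fset ->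
  cell_measure (cylinder (restrict y L)) =
  ((expR (cell_cocycle lam x y))%:E * cell_measure (cylinder (restrict x L)))%E.
Proof.
move=> xy FL; rewrite !cell_measureE -nneseriesZl //; last first.
  by move=> k _; apply: mule_ge0 => //; apply: sume_ge0.
apply: eq_eseriesr => k _; rewrite muleCA; congr (_ * _)%E; rewrite ge0_sume_distrr //.
apply: eq_bigr => r _; apply: law_ratio => //.
exact: periodic_walls_left_recurrent.
Qed.

End Mixture.

(** * The support, and the Markov property *)

(** A forbidden pattern in [x] is seen in a finite window. *)
Lemma sft_complement (A : finPointedType) (X : set (config A)) x :
  is_nn_sft X -> ~ X x ->
  exists W, forall y, cylinder (restrict x W) y -> ~ X y.
Proof.
move=> [forbid _ ->] /existsNP[a /existsNP[n /not_implyP[fa /contrapT ax]]].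
exists [fset (m + n)%R | m in domf a]%fset => y /cylinder_restrict yx.
move=> /(_ a n fa); apply; move/cylinderP: ax => ax; apply/cylinderP => m ma.
rewrite ax // /shift yx //; apply/imfsetP; by exists m.
Qed.

Lemma cell_constant x (l i j : int) : cell_shift x -> l <= i ->
  (forall t : int, l <= t <= i -> x (t, j) <> None) -> x (i, j) = x (l, j).
Proof.
move=> [_ horiz] li; have -> : i = l + (absz (i - l)%R)%:Z by lia.
elim: (absz _) => [|k IH] xt; first by rewrite addr0.
have {IH}IH : x (l + k%:Z, j) = x (l, j) by apply: IH => t tk; apply: xt; lia.
have := xt (l + k.+1%:Z); have -> : l + k.+1%:Z = l + k%:Z + 1 by lia.
have := xt (l + k%:Z) _; rewrite -IH.
case xk : (x (l + k%:Z, j)) => [b|]; last by move=> /(_ _ erefl) []; lia.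
move=> _; have := horiz _ _ _ xk; case: (x (_ + 1, j)) => [c|]; last first.
  by move=> _ /(_ _)[]//; lia.
by case: b c {xk IH} => [] [].
Qed.

(** The period 2 K + 2 leaves room for the prescribed interval and for one more
    wall, which ends the cells inside the interval on the left. *)
Lemma periodic_walls_extend (q : int -> bool) (K : nat) : exists k
    (r : {ffun 'I_k.+2 -> bool}), periodic_walls r (- K%:Z - 1) /\
  forall i : int, (absz i <= K)%N -> periodic_walls r i = q i.
Proof.
pose P := (2 * K)%N.
pose rep (c : 'I_P.+2) : int := 
  if (c <= K)%N then (c : nat)%:Z else (c : nat)%:Z - P.+2%:Z.
pose r : {ffun 'I_P.+2 -> bool} := [ffun c => (rep c == - K%:Z - 1) || q (rep c)].
have repE i : - K%:Z - 1 <= i <= K%:Z -> rep i%:~R = i.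
  have nat_rep (n : nat) : (n < P.+2)%N -> ((n%:R : 'I_P.+2) : nat) = n.
    by move=> nP; rewrite Zp_nat /= modn_small.
  move=> iK; case: (lerP 0 i) => i0.
    have -> : i = (absz i)%:Z by lia.
    by rewrite /rep -pmulrn nat_rep; [rewrite ifT //; lia|rewrite /P; lia].
  have -> : (i%:~R : 'I_P.+2) = (absz (i + P.+2%:Z)%R)%:R.
    rewrite pmulrn.
    have -> : (absz (i + P.+2%:Z)%R)%:Z = i + P.+2%:Z by rewrite /P; lia.
    have P0 : P.+2%:R = 0 :> 'I_P.+2 by exact: (@pchar_Zp P.+2).
    by rewrite intrD -pmulrn P0 addr0.
  by rewrite /rep nat_rep; [rewrite ifF; rewrite /P; lia|rewrite /P; lia].
have rwall : r (- K%:Z - 1)%:~R by rewrite ffunE repE ?eqxx //; lia.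
exists P, r; split=> [|i iK]; rewrite /periodic_walls; first by rewrite rwall.
rewrite ffunE repE; last by lia.
rewrite (_ : (i == _) = false); last by apply/eqP; lia.
by rewrite orFb orb_idr //= => /forallP/(_ (- K%:Z - 1)%:~R); rewrite rwall.
Qed.

(** The additional wall makes the leftmost site of every cell fall in the range
    where the walls are those of [x], so that it has the colour of [x]. *)
Lemma paint_periodic x (W : {fset site}) : cell_shift x -> exists k
    (r : {ffun 'I_k.+2 -> bool}) s,
    forall n, n \in W -> paint (periodic_walls r) s n = x n.
Proof.
move=> Yx; pose K := \max_(n <- W) absz n.1.
have [k [r [rK rx]]] := periodic_walls_extend (walls x 0) K.
exists k, r, (fun d => x d == Some true) => -[i j] nW.
have iK : (absz i <= K)%N by rewrite /K (big_rem (i, j)) //= leq_maxl.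
have xE (t : int) : (absz t <= K)%N -> periodic_walls r t = (x (t, j) == None).
  by move=> tK; rewrite rx // /walls (wall_column _ _ j Yx).
rewrite /paint /= xE //; case: eqP => [->//|xij].
have [li ql nq] := startP i (periodic_walls_left_recurrent r).
set l := start _ i in li ql nq *.
have Kl : - K%:Z <= l.
  rewrite leNgt; apply/negP => lK.
  have : ~~ periodic_walls r (- K%:Z - 1) by apply: nq; lia.
  by rewrite rK.
rewrite (_ : x (i, j) = x (l, j)); last first.
  apply: (cell_constant Yx li) => t lti; have [->//|ti] := eqVneq t i.
  apply/eqP; rewrite -xE; last by lia.
  by apply: nq; lia.
have : x (l, j) <> None.
  have [->//|li'] := eqVneq l i; apply/eqP; rewrite -xE; last by lia.
  by apply: nq; lia.
by case: (x (l, j)) => [[]|].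
Qed.

(** Paintings lie in the cell shift, and by [paint_periodic] every window of a
    point of the cell shift has positive probability for some periodic walls. *)
Lemma cell_measure_support (R : realType) (lam : nat -> R) :
  msupport (cell_measure lam) = cell_shift.
Proof.
apply/seteqP; split=> x.
  move=> xsupp; apply: contrapT => nYx.
  have [W WY] := sft_complement cell_shift_sft nYx.
  suff : (0%E < 0%E :> \bar R)%E by rewrite ltxx.
  by rewrite -[X in (_ < X)%E](cell_measure_null lam WY); exact: support_cylinder.
move=> Yx U oU Ux; have [W WU] := open_sub_cylinder oU Ux.
have [k [r [s sx]]] := paint_periodic W Yx.
apply: (@lt_le_trans _ _ (cell_measure lam (cylinder (restrict x W)))).
  apply: (cell_measure_ge_law (r := r)); rewrite (law_cylinder lam sx) lte_fin.
  by apply: prodr_gt0 => d _; apply: coin_weight_gt0; exact: bias01.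
apply: le_measure => //; rewrite inE; first exact: measurable_cylinder.
exact: sub_sigma_algebra.
Qed.

Lemma cell_measure_corresponds (R : realType) (lam : nat -> R) :
  corresponds cell_shift (cell_measure lam) (cell_cocycle lam).
Proof.
pose mu : probability (borel_config letter) R := cell_measure lam.
move=> x y L xy FL; have [Yx _ _] := xy.
have ratio : mu (cylinder (restrict y L)) =
    ((expR (cell_cocycle lam x y))%:E * mu (cylinder (restrict x L)))%E.
  exact: cell_measure_ratio.
have x0 : (0 < mu (cylinder (restrict x L)))%E.
  by apply: support_cylinder; rewrite cell_measure_support.
have fx : mu (cylinder (restrict x L)) \is a fin_num.
  by apply: fin_num_measure; exact: measurable_cylinder.
rewrite -/mu ratio -(fineK fx) /= mulfK // gt_eqF // fine_gt0 // x0 /=.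
by rewrite -ge0_fin_numE.
Qed.

Lemma cell_measure_mrf (R : realType) (lam : nat -> R) :
  is_shift_inv_mrf_on cell_shift (cell_measure lam).
Proof.
split; [|exact: cell_measure_shift|exact: cell_measure_support].
exact: (corresponds_mrf cell_shift_sft (cell_measure_support lam)
  (cell_measure_corresponds lam)).
Qed.

(** * The family of cocycles, and a cocycle of quadratic growth *)

Lemma card_strip_diff w :
  #|` diff_sites (strip w (Some false)) (strip w (Some true))| = w.
Proof.
rewrite (_ : diff_sites _ _ = strip_cell w); last first.
  apply/fsetP => n; rewrite (fset_diff_sites _ (strip_asymptotic w)) mem_strip_cell.
  by apply/idP/idP => [/eqP/strip_diff//|/strip_diff/eqP].
by rewrite card_imfset /= ?undup_id ?iota_uniq ?size_iota // => i j [].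
Qed.

Section Family.
Context {R : realType}.

Definition power_cocycle (s : R) : pair_fun letter R :=
  cell_cocycle (fun w => s ^+ w.-1).

(** On the strip of width m + 1 a dependency reads [\sum_j c j * s j ^+ m = 0], so
    it holds for all polynomials; take the one that vanishes at all [s j] but
    one. *)
Lemma power_cocycle_independent : linearly_independent cell_shift power_cocycle.
Proof.
move=> k s c injs rel j0.
have power_rel m : \sum_j c j * s j ^+ m = 0.
  rewrite -[RHS](rel _ _ (strip_asymptotic m.+1)); apply: eq_bigr => j _.
  by rewrite /power_cocycle cell_cocycle_strip.
have poly_rel (p : {poly R}) : \sum_j c j * p.[s j] = 0.
  under eq_bigr => j _ do rewrite horner_coef mulr_sumr.
  rewrite exchange_big big1 //= => m _.
  under eq_bigr => j _ do rewrite mulrCA.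
  by rewrite -mulr_sumr power_rel mulr0.
have := poly_rel (\prod_(j | j != j0) ('X - (s j)%:P)).
rewrite (bigD1 j0) //= [X in _ + X]big1 ?addr0 => [/eqP|j jj0]; last first.
  by rewrite horner_prod (bigD1 j) //= hornerXsubC subrr mul0r mulr0.
rewrite mulf_eq0 => /orP[/eqP //|].
rewrite horner_prod prodf_seq_eq0 => /hasP[j _ /andP[jj0]].
by rewrite hornerXsubC subr_eq0 => /eqP/injs E; rewrite E eqxx in jj0.
Qed.

Lemma reals_uncountable : ~ countable [set: R].
Proof.
move=> /countable_lebesgue_measure0 R0.
have : (lebesgue_measure `[0%R : R, 1%R]%classic <= lebesgue_measure [set: R])%E.
  by apply: le_measure => //; rewrite inE //; exact: measurable_itv.
by rewrite R0 lebesgue_measure_itv /= lte01 sube0 lee_fin ler10.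
Qed.

(** On the strip of width w the cocycle is w ^ 2, against a bound linear in w. *)
Lemma square_cocycle_not_gibbs (phi : pattern letter -> R) :
  finite_range cell_shift phi -> shift_inv_interaction cell_shift phi ->
  ~ (forall x y, asymptotic_pair cell_shift x y ->
     cell_cocycle (fun w => w%:R ^+ 2) x y = gibbs_cocycle phi x y).
Proof.
move=> rng inv phiE; have [C leC] := gibbs_cocycle_le cell_shift_sft inv rng.
pose w := (Num.truncn `|C|).+1.
have := leC _ _ (strip_asymptotic w).
rewrite -phiE ?cell_cocycle_strip ?card_strip_diff //; last exact: strip_asymptotic.
rewrite ger0_norm ?exprn_ge0 // expr2 ler_pM2r ?ltr0n // leNgt => /negP; apply.
by apply: le_lt_trans (ler_norm C) _; exact: truncnS_gt.
Qed.

End Family.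

Theorem mainTheorem7 (R : realType) :
  exists (A : finPointedType) (Y : set (config A)),
    is_nn_sft Y /\
    ~ pivot_property Y /\
    (exists (I : Type) (M : I -> pair_fun A R),
       [/\ ~ countable [set: I],
           linearly_independent Y M,
           forall i, is_shift_inv_markov_cocycle Y (M i) &
           forall i, exists mu : probability (borel_config A) R,
             is_shift_inv_mrf_on Y mu /\ corresponds Y mu (M i)]) /\
    (exists (J : Type) (B : J -> pair_fun A R),
       is_basis_of_cocycles Y B /\ ~ countable [set: J]) /\
    (exists (mu : probability (borel_config A) R) (M : pair_fun A R),
       [/\ is_shift_inv_mrf_on Y mu,
           is_markov_cocycle Y M,
           corresponds Y mu M &
           forall phi : pattern A -> R,
             finite_range Y phi -> shift_inv_interaction Y phi ->
             ~ (forall x y, asymptotic_pair Y x y ->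
                  M x y = gibbs_cocycle phi x y)]).
Proof.
exists letter, cell_shift.
split; [exact: cell_shift_sft|split; [exact: cell_shift_no_pivot|split; [|split]]].
- exists R, power_cocycle; split=> [||s|s].
  + exact: reals_uncountable.
  + exact: power_cocycle_independent.
  + exact: cell_cocycle_shift.
  + exists (cell_measure (fun w => s ^+ w.-1)); split.
      exact: cell_measure_mrf.
    exact: cell_measure_corresponds.
- apply: (extend_to_basis _ power_cocycle_independent reals_uncountable) => s.
  exact: cell_cocycle_shift.
- exists (cell_measure (fun w => w%:R ^+ 2)), (cell_cocycle (fun w => w%:R ^+ 2)).
  split=> [|||phi].
  + exact: cell_measure_mrf.
  + exact: cell_cocycle_markov.
  + exact: cell_measure_corresponds.
  + exact: square_cocycle_not_gibbs.
Qed.
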